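(* Let $X=(x_0,x_1)$ with $x_0<x_1$, and let $\zeta:X\to\mathbb{R}_{+}$ be bounded, positive and absolutely continuous on $X$, with $1/\zeta$ bounded. Write $\alpha=-\tfrac12(\log\zeta)'$. For $x_0<x\le x_1$ and $\sigma\in\mathbb{R}$ set $$w(x_0,x,\sigma)=e^{-i(x-x_0)\sigma}\,\mathrm{Sinh}^{(x_0,x)}_\alpha(\sigma),\qquad z(x_0,x,\sigma)=e^{-i(x-x_0)\sigma}\,\mathrm{Cosh}^{(x_0,x)}_\alpha(\sigma),\qquad G=\begin{pmatrix}z&-w\\ -\bar w&\bar z\end{pmatrix}.$$ Then $G(x_0,x,\sigma)\in SU(1,1)$. Moreover, for each $\sigma\in\mathbb{R}$ and each prescribed value $A(x_0+,\sigma)\in\mathbb{C}^2$, the unique solution on $X$ of the first-order system $$A'+\begin{pmatrix}i\sigma&\alpha(x)\\ \alpha(x)&-i\sigma\end{pmatrix}A=0$$ (the prime denoting $d/dx$) having that right-hand limit at $x_0$ is $$A(x,\sigma)=G(x_0,x,\sigma)\,A(x_0+,\sigma)\qquad(x_0<x<x_1).$$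
   Context: $SU(1,1)$ is the group of $2\times2$ complex matrices $U$ with $\det U=1$ and $U^*\Lambda U=\Lambda$, where $\Lambda=\mathrm{diag}(1,-1)$. Solutions $A=\binom{a}{b}$ of the system are $\mathbb{C}^2$-valued absolutely continuous functions of $x$ satisfying the system almost everywhere. (For $\sigma\ne0$ the system is equivalent to $(\zeta u')'+\sigma^2\zeta u=0$ via $a=\frac{\sqrt\zeta}{2}\left(u-\frac{1}{i\sigma}u'\right)$, $b=\frac{\sqrt\zeta}{2}\left(u+\frac{1}{i\sigma}u'\right)$.) Harmonic exponential operator. For an interval $(p,r)$ and a real-valued $\alpha$ integrable on $(p,r)$, define for $\sigma\in\mathbb{C}$ $$E^{(p,r)}_\alpha(\sigma)=1+\sum_{j=1}^\infty\ \int_{p<s_1<\cdots<s_j<r}e^{2i\sigma\kappa(s_1,\ldots,s_j)}\prod_{\nu=1}^j\alpha(s_\nu)\,ds_1\cdots ds_j,$$ where $\kappa(s_1,\ldots,s_j)=(s_j-s_{j-1})+(s_{j-2}-s_{j-3})+\cdots+(s_2-s_1)$ if $j$ is even, and $\kappa(s_1,\ldots,s_j)=(s_j-s_{j-1})+(s_{j-2}-s_{j-3})+\cdots+(s_3-s_2)+(s_1-p)$ if $j$ is odd (so $\kappa(s_1)=s_1-p$ for $j=1$). Further, $\mathrm{Cosh}^{(p,r)}_\alpha=\frac12\left(E^{(p,r)}_\alpha+E^{(p,r)}_{-\alpha}\right)$ and $\mathrm{Sinh}^{(p,r)}_\alpha=\frac12\left(E^{(p,r)}_\alpha-E^{(p,r)}_{-\alpha}\right)$.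 *)

(* Defs.v *)
From HB Require Import structures.
From mathcomp Require Import all_boot all_order all_algebra.
From mathcomp Require Import complex.
From mathcomp Require Import all_classical all_reals all_analysis.

Set Implicit Arguments.
Unset Strict Implicit.
Unset Printing Implicit Defensive.

Import Order.TTheory GRing.Theory Num.Theory.
Import numFieldNormedType.Exports.

Local Open Scope classical_set_scope.
Local Open Scope ring_scope.
Local Open Scope complex_scope.
Local Open Scope sesquilinear_scope.

(* The library puts the norm topology on [R[i]^o] only; export it to [R[i]]. *)
HB.instance Definition _ (R : rcfType) := PseudoPointedMetric.copy R[i] R[i]^o.
HB.instance Definition _ (R : rcfType) := NormedModule.copy R[i] R[i]^o.

(* The scalar ring [K] carrying the norm of [V] need not be [R]: the norm of
   ['cV[R[i]]_2] takes its values in [R[i]], where [0 < e] forces [e] to be a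
   positive real. *)
Definition abs_continuous (R : realType) (K : numDomainType)
    (V : normedZmodType K) (D : set R) (f : R -> V) : Prop :=
  forall e : K, 0 < e -> exists2 d : R, 0 < d &
    forall (n : nat) (a b : 'I_n -> R),
      (forall k, a k < b k /\ `[a k, b k] `<=` D) ->
      trivIset setT (fun k => `]a k, b k[%classic) ->
      \sum_(k < n) (b k - a k) < d ->
      \sum_(k < n) `|f (b k) - f (a k)| < e.

(* Difference quotients are scaled by hand because [R[i]] is not a normed module
   over [R] in the library. *)
Definition has_derivative (R : realType) (m : nat) (A : R -> 'cV[R[i]]_m)
    (x : R) (L : 'cV[R[i]]_m) : Prop :=
  (h^-1)%:C *: (A (x + h) - A x) @[h --> 0^'] --> L.

Definition cexp (R : realType) (z : R[i]) : R[i] :=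
  (expR (complex.Re z))%:C *
    (cos (complex.Im z) +i* sin (complex.Im z)).

Definition cintegral (R : realType) (D : set R) (f : R -> R[i]) : R[i] :=
  (\int[lebesgue_measure]_(x in D) complex.Re (f x)) +i*
  (\int[lebesgue_measure]_(x in D) complex.Im (f x)).

(* The integral of [F [:: s_1; ...; s_j]] over p < s_1 < ... < s_j < r, as an
   iterated Lebesgue integral with s_j outermost. *)
Fixpoint simplex_integral (R : realType) (j : nat) (p r : R)
    (F : seq R -> R[i]) {struct j} : R[i] :=
  match j with
  | 0%N => F [::]
  | j'.+1 => cintegral `]p, r[
               (fun s => simplex_integral j' p s (fun u => F (rcons u s)))
  end.

(* (s_j - s_(j-1)) + (s_(j-2) - s_(j-3)) + ..., ending with s_2 - s_1 if j is
   even and with s_1 - p if j is odd: [nth] at position 0 of [p :: s] is p. *)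
Definition kappa (R : realType) (p : R) (s : seq R) : R :=
  \sum_(k < uphalf (size s))
    (nth 0 (p :: s) (size s - k.*2) - nth 0 (p :: s) (size s - k.*2.+1)).

Definition harm_exp (R : realType) (p r : R) (alpha : R -> R) (sigma : R[i]) :
    R[i] :=
  1 + \big[+%R/0]_(1 <= j <oo)
        simplex_integral j p r (fun s =>
          cexp (2 * 'i%C * sigma * (kappa p s)%:C) *
          (\prod_(t <- s) alpha t)%:C).

Definition harm_cosh (R : realType) (p r : R) (alpha : R -> R) (sigma : R[i]) :
    R[i] :=
  2^-1 * (harm_exp p r alpha sigma + harm_exp p r (fun t => - alpha t) sigma).

Definition harm_sinh (R : realType) (p r : R) (alpha : R -> R) (sigma : R[i]) :
    R[i] :=
  2^-1 * (harm_exp p r alpha sigma - harm_exp p r (fun t => - alpha t) sigma).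

(* [^`()] is total, with an irrelevant value at the points (a null set when
   [zeta] is absolutely continuous) where the derivative does not exist. *)
Definition reflectivity (R : realType) (zeta : R -> R) (x : R) : R :=
  - 2^-1 * ((fun y : R => ln (zeta y))^`())%classic x.

Definition mx22 (C : Type) (a b c d : C) : 'M[C]_2 :=
  \matrix_(i < 2, j < 2)
    if i == ord0 then (if j == ord0 then a else b)
    else (if j == ord0 then c else d).

Definition Lambda (R : realType) : 'M[R[i]]_2 := mx22 1 0 0 (-1).

Definition SU11 (R : realType) : set 'M[R[i]]_2 :=
  [set U | \det U = 1 /\ U ^t* *m Lambda R *m U = Lambda R].

Definition w_coef (R : realType) (alpha : R -> R) (x0 x sigma : R) : R[i] :=
  cexp (- 'i%C * (x - x0)%:C * sigma%:C) * harm_sinh x0 x alpha sigma%:C.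

Definition z_coef (R : realType) (alpha : R -> R) (x0 x sigma : R) : R[i] :=
  cexp (- 'i%C * (x - x0)%:C * sigma%:C) * harm_cosh x0 x alpha sigma%:C.

Definition Gmx (R : realType) (alpha : R -> R) (x0 x sigma : R) : 'M[R[i]]_2 :=
  let w := w_coef alpha x0 x sigma in
  let z := z_coef alpha x0 x sigma in
  mx22 z (- w) (- w^*) z^*.

Definition sysmx (R : realType) (alpha : R -> R) (sigma x : R) : 'M[R[i]]_2 :=
  mx22 ('i%C * sigma%:C) (alpha x)%:C (alpha x)%:C (- ('i%C * sigma%:C)).

Definition is_solution (R : realType) (alpha : R -> R) (sigma x0 x1 : R)
    (A : R -> 'cV[R[i]]_2) : Prop :=
  abs_continuous `]x0, x1[ A /\
  {ae (@lebesgue_measure R), forall x, x0 < x < x1 ->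
     exists2 L, has_derivative A x L & L + sysmx alpha sigma x *m A x = 0}.

(* Main.v *)
(* A density g of log zeta exists: the total variation of an absolutely
   continuous function is absolutely continuous, so its Stieltjes measure has a
   Radon-Nikodym derivative, and Lebesgue differentiation identifies it with the
   pointwise derivative almost everywhere. Hence alpha may be replaced by an
   integrable Borel function without changing the iterated integrals.

   Since kappa(s_1,...,s_j) + kappa(s_1,...,s_(j-1)) = s_j - p, for real sigma
   the series E of the harmonic exponential satisfies
     E(r) = 1 + int_p^r alpha(s) e^(2 i sigma (s - p)) conj(E(s)) ds,
   its j-th term being O(M^j / j!) with M the mass of 2 |alpha|. Taking E for
   alpha and -alpha gives
     z' = - i sigma z + alpha conj(w),   w' = - i sigma w + alpha conj(z),
   with z = 1 and w = 0 at x0. So z conj(z) - w conj(w) has derivative zero almost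
   everywhere and is 1, the columns of G solve the system, and for any solution B
   the vector G^(-1) B is absolutely continuous with derivative zero almost
   everywhere, hence constant. *)
Require Import Defs.
From HB Require Import structures.
From mathcomp Require Import all_boot all_order all_algebra.
From mathcomp Require Import complex ring lra.
From mathcomp Require Import all_classical all_reals all_analysis.
From mathcomp Require Import measurable_realfun.

Set Implicit Arguments.
Unset Strict Implicit.
Unset Printing Implicit Defensive.

Import Order.TTheory GRing.Theory Num.Theory.
Import numFieldNormedType.Exports.

Local Open Scope classical_set_scope.
Local Open Scope ring_scope.

(** * Absolute continuity in terms of finite lists of intervals *)

Section interval_lists.
Context {R : realType}.
Implicit Types (p q : R * R) (s t : seq (R * R)) (f : R -> R).

(** The values of [reflectivity] where [ln zeta] has no derivative are arbitrary, so no
    measurability is at hand for it. This is why an integrable [g] on the whole line takes its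
    place, and why the exchange rests on a lemma about integrals of arbitrary functions. Having [g]
    on the whole line makes all bounds uniform in the upper limit of integration and turns the end
    point [x1] into an interior point. The Stieltjes measure needs a monotone function on the line,
    whereas [zeta] is controlled on an open interval only: an absolutely continuous function is
    therefore extended to the line through its limits at the end points and kept constant beyond
    them. Conjugation is reached through the frequency. Splitting off the outermost variable of a
    term reverses the sign of [sigma], so the recursion alternates between [sigma] and [- sigma];
    since [g] is real, that reversal is complex conjugation. Limits, derivatives and integrals are
    all taken on real and imaginary parts. *)

Definition itv_disj p q := (p.2 <= q.1) || (q.2 <= p.1).

Definition itv_family s := all (fun p => p.1 <= p.2) s && pairwise itv_disj s.

Definition total_length s := \sum_(p <- s) (p.2 - p.1).

Definition oscillation f s := \sum_(p <- s) `|f p.2 - f p.1|.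

(** The non-strict bound [<= e] survives pointwise limits of functions, which is how the extension
    to the whole line is obtained. *)
Definition list_ac (D : pred R) f := forall e, 0 < e -> exists2 d, 0 < d &
  forall s, itv_family s -> all (fun p => D p.1 && D p.2) s ->
    total_length s < d -> oscillation f s <= e.

Lemma itv_disj_sym : symmetric itv_disj.
Proof. by move=> p q; rewrite /itv_disj orbC. Qed.

Lemma list_acN (D : pred R) f : list_ac D f -> list_ac D (\- f).
Proof.
move=> fac e e0; have [d d0 df] := fac e e0; exists d => // s sf sD sd.
rewrite (le_trans _ (df s sf sD sd))// /oscillation ler_sum// => p _.
by rewrite -opprD normrN.
Qed.

Lemma list_acD (D : pred R) f g : list_ac D f -> list_ac D g -> list_ac D (f \+ g).
Proof.
move=> fac gac e e0; have e20 : 0 < e / 2 by rewrite divr_gt0.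
have [d d0 df] := fac _ e20; have [d' d'0 dg] := gac _ e20.
exists (Num.min d d'); first by rewrite lt_min d0.
move=> s sf sD; rewrite lt_min => /andP[sd sd'].
rewrite (splitr e) (le_trans _ (lerD (df s sf sD sd) (dg s sf sD sd')))//.
rewrite /oscillation -big_split/= ler_sum// => p _.
by rewrite opprD addrACA ler_normD.
Qed.

Lemma pairwise_filter (T : eqType) (r : rel T) (a : pred T) (s : seq T) :
  pairwise r s -> pairwise r (seq.filter a s).
Proof. by apply: subseq_pairwise; exact: filter_subseq. Qed.

(** Degenerate intervals contribute zero to both sums and can be filtered out; what is left has
    strict inequalities and disjoint interiors. *)
Lemma abs_continuous_list_ac (x0 x1 : R) f :
  abs_continuous `]x0, x1[ f -> list_ac (fun x => x0 < x < x1) f.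
Proof.
move=> fac e e0; have [d d0 df] := fac e e0; exists d => // s /andP[sle sd] sD slen.
pose t := [seq p <- s | p.1 < p.2].
have tE F : (forall p, p.1 = p.2 -> F p = 0) ->
    \sum_(p <- s) F p = \sum_(i < size t) (F (tnth (in_tuple t) i) : R).
  move=> F0; rewrite -(big_tuple 0 +%R (in_tuple t) xpredT) /t big_filter.
  rewrite [LHS](bigID (fun p => p.1 < p.2))/= [X in _ + X]big1_seq ?addr0//.
  move=> p /andP[]; rewrite -leNgt => p21 /(allP sle) p12.
  by apply: F0; apply/eqP; rewrite eq_le p12.
rewrite /oscillation tE; last by move=> p ->; rewrite subrr normr0.
apply/ltW/(df _ (fun i => (tnth (in_tuple t) i).1)
                (fun i => (tnth (in_tuple t) i).2)).
- move=> k; set p := tnth _ _.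
  have : p \in t by rewrite mem_tnth.
  rewrite mem_filter => /andP[pl ps]; split => // x /=.
  rewrite !in_itv/=; have /andP[/andP[h1 _] /andP[_ h2]] := allP sD _ ps.
  by move=> /andP[px xp]; rewrite (lt_le_trans h1)// (le_lt_trans xp).
- apply/trivIsetP => i j _ _ ij; apply/seteqP; split => [x []|x []].
  rewrite /= !in_itv/= => /andP[ix xi] /andP[jx xj].
  have H : {in gtn (size t) &, {homo nth (0, 0) t : i j / (i < j)%N >-> itv_disj i j}}.
    by apply/pairwiseP; exact: pairwise_filter.
  have : itv_disj (tnth (in_tuple t) i) (tnth (in_tuple t) j).
    rewrite !(tnth_nth (0, 0)); move: ij; rewrite -(inj_eq val_inj) neq_ltn.
    by case/orP => ij; [|rewrite itv_disj_sym]; apply: H; rewrite ?inE.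
  rewrite /itv_disj => /orP[].
    by move/(lt_le_trans xi); rewrite ltNge (ltW jx).
  by move/(lt_le_trans xj); rewrite ltNge (ltW ix).
- by rewrite -(tE (fun p => p.2 - p.1))// => p ->; rewrite subrr.
Qed.

Definition clamp (l r x : R) := Num.max l (Num.min r x).

Lemma clamp_le l r x y : x <= y -> clamp l r x <= clamp l r y.
Proof.
rewrite /clamp => xy; case: (leP r x) => ?; case: (leP r y) => ?;
  by case: (leP l x) => ?; case: (leP l y) => ?; case: (leP l r) => ?; lra.
Qed.

Lemma clampE l r x : l <= x <= r -> clamp l r x = x.
Proof. by move=> /andP[lx xr]; rewrite /clamp min_r// max_r. Qed.

Lemma clamp_itv l r x : l <= r -> l <= clamp l r x <= r.
Proof.
by rewrite /clamp => lr; case: (leP r x) => ?; case: (leP l x) => ?; case: (leP l r) => ?; lra.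
Qed.

Lemma clamp_sub l r x y : l <= r -> x <= y ->
  clamp l r y - clamp l r x <= y - x.
Proof.
rewrite /clamp => lr xy; case: (leP r x) => ?; case: (leP r y) => ?;
  by case: (leP l x) => ?; case: (leP l y) => ?; case: (leP l r) => ?; lra.
Qed.

Lemma itv_family_homo (h : R -> R) s : {homo h : x y / x <= y} ->
  itv_family s -> itv_family [seq (h p.1, h p.2) | p <- s].
Proof.
move=> hh /andP[sl sd]; apply/andP; split.
  by rewrite all_map; apply: sub_all sl => p /= /hh.
rewrite pairwise_map; apply: sub_pairwise sd => p q /orP[] /hh pq;
  by rewrite /itv_disj/= pq ?orbT.
Qed.

(** A nondecreasing map that does not stretch lengths sends a family to a family of no larger total
    length, so the same [d] serves. *)
Lemma list_ac_comp (D : pred R) f (h : R -> R) : {homo h : x y / x <= y} ->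
  (forall x y, x <= y -> h y - h x <= y - x) -> (forall x, D (h x)) ->
  list_ac D f -> list_ac xpredT (f \o h).
Proof.
move=> hh hc hD fac e e0; have [d d0 df] := fac e e0; exists d => // s sf _ sd.
have := df _ (itv_family_homo hh sf); rewrite /oscillation /total_length !big_map.
apply; first by apply/allP => _ /mapP[p ps ->]; rewrite !hD.
rewrite (le_lt_trans _ sd)// /total_length big_seq [leRHS]big_seq ler_sum// => p ps.
by case/andP : sf => /allP/(_ _ ps) pp _; exact: hc.
Qed.
End interval_lists.

Section list_ac_extension.
Context {R : realType}.

Lemma list_ac_dist (D : pred R) (f : R -> R) : list_ac D f ->
  forall e, 0 < e -> exists2 d, 0 < d &
    forall x y, D x -> D y -> `|x - y| < d -> `|f x - f y| <= e.
Proof.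
move=> fac e /fac[d d0 df]; exists d => // x y.
wlog xy : x y / y <= x => [hw Dx Dy xy|Dx Dy].
  have [yx|/ltW yx] := leP y x; first exact: hw.
  by rewrite distrC hw// distrC.
rewrite ger0_norm ?subr_ge0// => xyd.
have := df [:: (y, x)]; rewrite /itv_family /total_length /oscillation.
by rewrite !big_seq1 /= xy Dx Dy => ->.
Qed.

(** Uniform continuity provides the limits at both ends. They are reached through maps [h n] of the
    line into the open interval that converge uniformly to the clamping map. *)
Lemma list_ac_extension (x0 x1 : R) (f : R -> R) : x0 < x1 ->
  list_ac (fun x => x0 < x < x1) f ->
  exists F : R -> R, [/\ list_ac xpredT F,
    forall x, x0 < x < x1 -> F x = f x,
    forall x, x <= x0 -> F x = F x0 & forall x, x1 <= x -> F x = F x1].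
Proof.
move=> x01 fac; pose m := (x0 + x1) / 2.
(* Clamp, then contract towards the midpoint with weight [1/(n+2)], which lies strictly between 0
   and 1: even the end points land inside. *)
pose h n x := clamp x0 x1 x + (m - clamp x0 x1 x) * n.+2%:R^-1 : R.
have c01 n : 0 < (n.+2%:R^-1 : R) < 1.
  by rewrite invr_gt0 ltr0Sn invf_lt1 ?ltr0Sn// ltr1n.
have cl x : x0 <= clamp x0 x1 x <= x1 by apply: clamp_itv; exact: ltW.
have hD n x : x0 < h n x < x1.
  rewrite /h /m; have := c01 n; have := cl x.
  move: (clamp _ _ _) n.+2%:R^-1 => z c /andP[z0 z1] /andP[c0 c1].
  have C1 : 0 < c * (x1 - x0) by rewrite mulr_gt0// subr_gt0.
  have C2 : 0 <= (1 - c) * (z - x0) by rewrite mulr_ge0// subr_ge0// ltW.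
  have C3 : 0 <= (1 - c) * (x1 - z) by rewrite mulr_ge0// subr_ge0// ltW.
  by apply/andP; split; lra.
have hcvg d : 0 < d -> \forall n \near \oo, forall x, `|h n x - clamp x0 x1 x| < d.
  move=> d0; have d1 : 0 < d / (x1 - x0) by rewrite divr_gt0 ?subr_gt0.
  have := near_infty_natSinv_lt (PosNum d1); apply: filterS => n /= nd x.
  have nd' : n.+2%:R^-1 < d / (x1 - x0).
    by rewrite (le_lt_trans _ nd)// lef_pV2 ?posrE ?ltr0Sn// ler_nat.
  rewrite /h addrC addKr normrM (gtr0_norm (proj1 (andP (c01 n)))).
  move: nd'; rewrite ltr_pdivlMr ?subr_gt0// => nd'.
  rewrite (le_lt_trans _ nd')// mulrC.
  rewrite ler_wpM2l ?invr_ge0// /m.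
  by have := cl x; move: (clamp _ _ _) => z; rewrite ler_norml; lra.
have fdist e : 0 < e -> exists2 d, 0 < d & forall x y, x0 < x < x1 ->
    x0 < y < x1 -> `|x - y| < d -> `|f x - f y| <= e by exact: list_ac_dist.
have fh x : cvg (f (h n x) @[n --> \oo]).
  apply/cauchy_cvgP/cauchy_exP => e e0.
  have [d d0 df] := fdist (e / 2) ltac:(by rewrite divr_gt0).
  have [N _ hN] := hcvg (d / 2) ltac:(by rewrite divr_gt0).
  exists (f (h N x)); exists N => // n nN; rewrite /ball/=.
  rewrite (@le_lt_trans _ _ (e / 2))//; last by lra.
  apply: df => //; rewrite (splitr d) -(subrKA (clamp x0 x1 x)).
  rewrite (le_lt_trans (ler_normD _ _))// ltrD//; first by apply: hN => /=.
  by rewrite distrC; exact: hN.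
pose F x := lim (f (h n x) @[n --> \oo]).
have Fcl x : F x = F (clamp x0 x1 x).
  by rewrite /F /h (@clampE _ _ _ (clamp _ _ x)).
exists F; split.
- move=> e e0; have [d d0 df] := fac e e0; exists d => // s sf _ sd.
  have : oscillation (f \o h n) s @[n --> \oo] --> oscillation F s.
    elim: s {sf sd} => [|p s IH]; rewrite /oscillation.
      under eq_fun do rewrite big_nil.
      by rewrite big_nil; exact: cvg_cst.
    under eq_fun do rewrite big_cons.
    by rewrite big_cons; apply: cvgD IH; apply: cvg_norm; apply: cvgB; exact: fh.
  move=> /(@ler_cvg_to _ _ _ _ _ (cst e) _ e); apply; first exact: cvg_cst.
  near=> n; rewrite /cst.
  (* Each [h n] is nondecreasing and 1-Lipschitz, so the [d] chosen for [f] works for all [n] at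
     once and the bound passes to the limit. *)
  have hd : forall x y, x <= y -> h n x <= h n y /\ h n y - h n x <= y - x.
    move=> x y xy.
    have := clamp_le x0 x1 xy; have := clamp_sub (ltW x01) xy; have := c01 n.
    rewrite /h.
    move: (clamp _ _ x) (clamp _ _ y) n.+2%:R^-1 => z w c /andP[c0 c1] zw wz.
    have : 0 <= (1 - c) * (w - z) by apply: mulr_ge0; rewrite subr_ge0// ltW.
    have : 0 <= c * (w - z) by apply: mulr_ge0; rewrite ?subr_ge0// ltW.
    by move=> ? ?; split; lra.
  have := df [seq (h n p.1, h n p.2) | p <- s].
  rewrite /oscillation /total_length !big_map; apply.
  + by apply: itv_family_homo => // x y /hd[].
  + by apply/allP => _ /mapP[p _ ->]/=; rewrite !hD.
  + rewrite (le_lt_trans _ sd)// /total_length big_seq [leRHS]big_seq.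
    apply: ler_sum => p ps.
    by case/andP : sf => /allP/(_ _ ps) pp _; exact: (hd _ _ pp).2.
- move=> x x01'; apply/cvg_lim; first exact: Rhausdorff.
  apply/cvgrPdist_le => e e0; have [d d0 df] := fdist e e0.
  have := hcvg d d0; apply: filterS => n /(_ x) nd; apply: df => //.
  by rewrite distrC; move: nd; rewrite clampE//; case/andP : x01' => /ltW -> /ltW ->.
- by move=> x xx0; rewrite Fcl [RHS]Fcl /clamp !min_r ?max_l// ?(ltW x01) ?(le_trans xx0 (ltW _)).
- by move=> x xx1; rewrite Fcl [RHS]Fcl /clamp !min_l.
Unshelve. all: by end_near. Qed.
End list_ac_extension.

(** * Total variation and Radon-Nikodym density *)

Section total_variation_list_ac.
Context {R : realType}.
Implicit Types (f F : R -> R) (s t : seq (R * R)).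

(** The last clause is what allows partitions of disjoint intervals to be concatenated into one
    family. *)
Lemma partition_family a b (u : seq R) : itv_partition a b u ->
  let t := zip (a :: u) u in
  [/\ itv_family t, total_length t = b - a,
      forall f, oscillation f t = variation a b f u &
      forall q, itv_disj q (a, b) -> all (itv_disj q) t].
Proof.
elim: u a => [a /itv_partition_nil <-|h u IH a] /=.
  rewrite /total_length /oscillation big_nil subrr; split => // f.
  by rewrite big_nil variation_nil.
move=> /[dup] auh /itv_partition_cons hub.
have [/andP[f1 f2] l o d] := IH _ hub.
have ah : a <= h by case: auh => /= /andP[/ltW].
have hb := itv_partition_le hub.
split.
- apply/andP; split => /=; first by rewrite ah f1.
  by rewrite f2 andbT d// /itv_disj/= lexx.
- by rewrite /total_length big_cons/= -/(total_length _) l addrC subrKA.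
- move=> f; have ah1 : itv_partition a h [:: h].
    by apply: itv_partition1; case: auh => /= /andP[].
  rewrite -[h :: u]cat1s (variation_cat _ ah hb)// -o /oscillation big_cons.
  by rewrite /variation big_nat1.
- by move=> q; rewrite /itv_disj/= => /orP[qa|bq]; rewrite ?qa ?(le_trans hb bq) ?orbT/=;
    apply: d; rewrite /itv_disj/= ?(le_trans qa ah) ?bq ?orbT.
Qed.

(** Each interval is cut by a partition whose variation misses the total variation by at most [e];
    the errors add up to [e *+ size s]. The last clause carries disjointness through the
    induction. *)
Lemma total_variation_refinement F s e : (forall x y, x <= y -> bounded_variation x y F) ->
  0 < e -> itv_family s -> exists t,
  [/\ itv_family t, total_length t = total_length s,
      \sum_(p <- s) fine (total_variation p.1 p.2 F) <= oscillation F t + e *+ size s &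
      forall q, all (itv_disj q) s -> all (itv_disj q) t].
Proof.
move=> Fbv e0; elim: s => [_|[a b] s IH /andP[/= /andP[ab sl] /andP[sd ss]]].
  by exists [::]; split => //; rewrite /oscillation !big_nil mulr0n addr0.
have [t [/andP[t1 t2] tl to td]] : exists t,
  [/\ itv_family t, total_length t = total_length s,
      \sum_(p <- s) fine (total_variation p.1 p.2 F) <= oscillation F t + e *+ size s &
      forall q, all (itv_disj q) s -> all (itv_disj q) t].
  by apply: IH; rewrite /itv_family sl.
have /(bounded_variationP _ ab) Tfin := Fbv _ _ ab.
have [u abu ue] : exists2 u, itv_partition a b u &
    fine (total_variation a b F) - e <= variation a b F u.
  have : (total_variation a b F - e%:E < total_variation a b F)%E.
    by rewrite lteBlDr// lteDl// lte_fin.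
  move=> /ereal_sup_gt[_ [_ [u abu <-] <-]] /ltW ue; exists u => //.
  by rewrite -lee_fin EFinB fineK.
have [/andP[u1 u2] ul uo ud] := partition_family abu.
exists (zip (a :: u) u ++ t); split.
- rewrite /itv_family all_cat u1 t1/= pairwise_cat u2 t2 !andbT.
  apply/allrelP => p q /= pu qt.
  have : all (itv_disj p) t; last by move=> /allP; exact.
  apply: td; apply/allP => r rs; rewrite itv_disj_sym.
  have : all (itv_disj r) (zip (a :: u) u); last by move=> /allP; exact.
  by apply: ud; rewrite itv_disj_sym; exact: (allP sd).
- rewrite [RHS]/total_length big_cons -[X in _ = _ + X]/(total_length s) -tl -[_ - _]ul.
  by rewrite /total_length big_cat.
- rewrite big_cons [X in _ <= X + _](_ : _ = variation a b F u + oscillation F t).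
    by rewrite mulrS; move: ue to => /=; lra.
  by rewrite -uo /oscillation big_cat.
- by move=> q /= /andP[qa qs]; rewrite all_cat ud// td.
Qed.

(** Below the length [d] that belongs to [e = 1], every partition has variation at most 1; a longer
    interval is walked through in steps of [d / 2], total variation being additive. *)
Lemma list_ac_bounded_variation F : list_ac xpredT F ->
  forall x y, x <= y -> bounded_variation x y F.
Proof.
move=> Fac; have [d d0 dF] := Fac _ ltr01.
have small x y : x <= y -> y - x < d -> bounded_variation x y F.
  move=> xy xyd; exists 1 => _ [u xyu <-].
  have [uf ul <- _] := partition_family xyu.
  by apply: dF => //; rewrite ?ul//; apply/allP.
have d20 : 0 < d / 2 by rewrite divr_gt0.
have H n x y : x <= y -> y - x <= (d / 2) *+ n -> bounded_variation x y F.
  elim: n x => [|n IH] x xy.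
    by rewrite mulr0n => yx; apply: small => //; lra.
  rewrite mulrS => yx; have [le1|gt1] := leP y (x + d / 2).
    by apply: small => //; lra.
  have xz : x <= x + d / 2 by lra.
  apply/bounded_variationP => //.
  rewrite (total_variationD _ xz (ltW gt1)) fin_numD; apply/andP; split.
    by apply/bounded_variationP => //; apply: small; lra.
  by apply/bounded_variationP; [exact: ltW|apply: IH; lra].
move=> x y xy; have := archi_boundP (divr_ge0 (_ : 0 <= y - x) (ltW d20)).
rewrite subr_ge0 => /(_ xy); rewrite ltr_pdivrMr// => /ltW yx.
by apply: (H (Num.bound ((y - x) / (d / 2)))) => //; rewrite -mulr_natl.
Qed.

(** A sum of total variations over a short family is nearly the oscillation of [F] over a
    refinement, which is just as short. *)
Lemma total_variation_list_ac (a b : R) F : a <= b -> list_ac xpredT F ->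
  list_ac xpredT (fun x => fine (total_variation a (clamp a b x) F)).
Proof.
move=> ab Fac; have bv := list_ac_bounded_variation Fac.
have fin x y : x <= y -> total_variation x y F \is a fin_num.
  by move=> xy; apply/bounded_variationP => //; exact: bv.
apply: (@list_ac_comp _ (fun x => a <= x) (fun x => fine (total_variation a x F))).
- by move=> x y; exact: clamp_le.
- by move=> x y; exact: clamp_sub.
- by move=> x; have /andP[] := clamp_itv x ab.
move=> e e0; have e20 : 0 < e / 2 by rewrite divr_gt0.
have [d d0 dF] := Fac _ e20; exists d => // s sf sa sd.
(* The accumulated error stays below [e / 2]; the successor keeps the divisor positive for the empty
   family. *)
have e30 : 0 < e / 2 / (size s).+1%:R by rewrite divr_gt0.
have [t [tf tl to _]] := total_variation_refinement bv e30 sf.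
rewrite (_ : oscillation _ s = \sum_(p <- s) fine (total_variation p.1 p.2 F)).
  rewrite (le_trans to)// [leRHS]splitr lerD//.
    by apply: dF => //; [apply/allP|rewrite tl].
  move: (e / 2) e20 => c c0.
  by rewrite -[leLHS]mulr_natr mulrAC ler_pdivrMr ?ltr0Sn// ler_wpM2l ?ltW// ltr_nat.
rewrite /oscillation big_seq [RHS]big_seq; apply: eq_bigr => p ps.
have /andP[a1 a2] := allP sa _ ps.
have p12 : p.1 <= p.2 by case/andP : sf => /allP/(_ _ ps).
rewrite (total_variationD _ a1 p12) fineD ?fin// addrC addKr ger0_norm//.
exact/fine_ge0/total_variation_ge0.
Qed.

End total_variation_list_ac.

(** * Stieltjes measures of monotone absolutely continuous functions *)

Section stieltjes_density.
Context {R : realType}.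
Local Notation mu := (@lebesgue_measure R).

(** Members of the ring are finite unions of disjoint nonempty half-open intervals. [get] recovers
    their end points, and [undup] turns disjointness of distinct sets into disjointness at distinct
    positions. *)
Lemma ring_ocitv_list (A : set R) :
  measurable (A : set (SetRing.type (ocitv_type R))) ->
  exists2 s : seq (R * R), itv_family s &
    A = \big[setU/set0]_(p <- s) `]p.1, p.2]%classic.
Proof.
move=> /SetRing.ring_finite_set[B [/finite_seqP[l ->]] Bn0 Btriv Bm ->].
pose P X : set (R * R) := [set p | p.1 < p.2 /\ X = `]p.1, p.2]%classic].
pose ends X : R * R := get (P X).
have endsP X : X \in l -> P X (ends X).
  move=> Xl; apply: getPex.
  have /ocitvP[X0|[p p12 Xp]] : ocitv X by exact: (Bm X (mem_set Xl)).
    by have := Bn0 _ Xl; rewrite X0 => -[].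
  by exists p.
exists (map ends (undup l)).
  apply/andP; split.
    by apply/allP => _ /mapP[X + ->]; rewrite mem_undup => /endsP[/ltW].
  rewrite pairwise_map; apply/(pairwiseP set0) => i j; rewrite !inE => il jl ij.
  set X := nth _ _ i; set Y := nth _ _ j.
  have Xl : X \in l by rewrite -mem_undup mem_nth.
  have Yl : Y \in l by rewrite -mem_undup mem_nth.
  have [X12 XE] := endsP _ Xl; have [Y12 YE] := endsP _ Yl.
  rewrite /relpre /itv_disj/=; have [//|h1] := leP (ends X).2 (ends Y).1.
  have [//|h2] := leP (ends Y).2 (ends X).1.
  suff : X = Y by move/eqP; rewrite nth_uniq ?undup_uniq// => /eqP ijE; rewrite ijE ltnn in ij.
  have : `](ends X).1, (ends X).2]%classic `&` `](ends Y).1, (ends Y).2]%classic !=set0.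
    (* If neither interval precedes the other, the smaller right end point belongs to both. *)
    exists (Num.min (ends X).2 (ends Y).2); split.
      by rewrite /= in_itv/= lt_min X12 h2/= ge_min lexx.
    by rewrite /= in_itv/= lt_min h1 Y12/= ge_min lexx orbT.
  by rewrite -XE -YE; exact: Btriv.
rewrite big_map -(bigcup_seq (undup l)).
have -> : [set` undup l] = [set` l] by apply/seteqP; split => x /=; rewrite mem_undup.
by apply: eq_bigcupr => X /= Xl; have [] := endsP _ Xl.
Qed.

Lemma stieltjes_itv (G : cumulative R R) (a b : R) : a <= b ->
  lebesgue_stieltjes_measure G `]a, b]%classic = (G b - G a)%:E.
Proof.
move=> ab; rewrite /lebesgue_stieltjes_measure/= /measure_extension/=.
rewrite measurable_mu_extE; last exact: is_ocitv.
by rewrite /= (wlength_itv_bnd _ _ _ ab).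
Qed.

(** A null set has a cover by half-open intervals of total length below [d]. The Stieltjes measure
    of each finite partial union is at most an oscillation of [G], hence at most [e], and continuity
    from below reaches the whole cover. *)
Lemma stieltjes_dominates (G : cumulative R R) : list_ac xpredT G ->
  lebesgue_stieltjes_measure G `<< mu.
Proof.
move=> Gac; apply/null_content_dominatesP => A mA A0.
apply/eqP; rewrite eq_le measure_ge0 andbT; apply/lee_addgt0Pr => e e0.
have [d d0 dG] := Gac e e0.
have [_ [B [Bm AB] <-] Bd] : exists2 y, [set \sum_(k <oo) wlength idfun (B k) |
    B in @measurable_cover _ (ocitv_type R) A]%E y & (y < d%:E)%E.
  by apply: ereal_inf_lt; rewrite [X in (X < _)%E](_ : _ = mu A)// A0 lte_fin.
pose C : nat -> set (measurableTypeR R) := B.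
have Cm i : measurable (C i) by exact: sub_sigma_algebra (Bm i).
have UCm : measurable (\bigcup_n C n) by exact: bigcup_measurable.
rewrite add0e (@le_trans _ _ (lebesgue_stieltjes_measure G (\bigcup_n C n)))//.
  by apply: le_measure => //; rewrite inE.
rewrite -bigcup_bigsetU_bigcup.
have Um n : measurable (\big[setU/set0]_(i < n.+1) C i : set (measurableTypeR R)).
  by apply: bigsetU_measurable => i _.
have Un n m : (n <= m)%N ->
    (\big[setU/set0]_(i < n.+1) C i <= \big[setU/set0]_(i < m.+1) C i)%O.
  by move=> nm; apply/subsetPset/subset_bigsetU.
have Ucvg := @nondecreasing_cvg_mu _ _ _ (lebesgue_stieltjes_measure G)
  (fun n => \big[setU/set0]_(i < n.+1) C i) Um (bigcup_measurable (fun i _ => Um i)) Un.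
rewrite -(cvg_lim _ Ucvg)//; apply: lime_le; first by apply/cvg_ex; eexists; exact: Ucvg.
apply: nearW => n /=.
(* Members of the cover may overlap, whereas [list_ac] speaks of disjoint intervals: the finite
   union is rewritten as a disjoint list, whose length is at most the sum of the lengths in the
   cover. *)
have [s sf sE] : exists2 s, itv_family s &
    \big[setU/set0]_(i < n.+1) C i = \big[setU/set0]_(p <- s) `]p.1, p.2]%classic.
  by apply: ring_ocitv_list; apply: bigsetU_measurable => i _; exact: SetRing.measurable_subring.
have sm p : measurable (`]p.1, p.2]%classic : set (measurableTypeR R)) by exact: measurable_itv.
have msm (t : seq (R * R)) : measurable (\big[setU/set0]_(p <- t) `]p.1, p.2]%classic : set (measurableTypeR R)).
  by apply: bigsetU_measurable.
have mule : ((total_length s)%:E <= mu (\big[setU/set0]_(p <- s) `]p.1, p.2]%classic))%E.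
  elim: s sf {sE} => [|p s IH /andP[/=/andP[p12 sl] /andP[pd sd]]].
    by rewrite /total_length !big_nil measure0.
  rewrite /total_length !big_cons measureU//.
    rewrite EFinD leeD//; first by rewrite [leRHS](stieltjes_itv idfun p12).
    by apply: IH; rewrite /itv_family sl.
  rewrite -subset0 => x [/= xp]; rewrite -bigcup_seq => -[q /= /(allP pd)].
  move: xp; rewrite /itv_disj !in_itv/= => /andP[px xp] /orP[] h /andP[qx xq].
    by move: qx; rewrite ltNge (le_trans xp h).
  by move: px; rewrite ltNge (le_trans xq h).
have nule : (lebesgue_stieltjes_measure G (\big[setU/set0]_(p <- s) `]p.1, p.2]%classic)
    <= (oscillation G s)%:E)%E.
  elim: s sf {sE mule} => [|p s IH /andP[/=/andP[p12 sl] /andP[pd sd]]].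
    by rewrite /oscillation !big_nil measure0.
  rewrite /oscillation !big_cons.
  apply: (le_trans (measureU2 (lebesgue_stieltjes_measure G) (sm p) (msm s))).
  rewrite EFinD leeD//.
    by rewrite [leLHS](stieltjes_itv G p12) lee_fin ler_norm.
  by apply: IH; rewrite /itv_family sl.
rewrite sE (le_trans nule)// lee_fin; apply: dG => //; first by apply/allP.
rewrite -lte_fin (le_lt_trans mule)// -sE (le_lt_trans _ Bd)//.
rewrite sE.
have := @content_subadditive _ _ _ mu _ C n.+1 (fun k _ => Cm k) (msm s).
rewrite -sE => /(_ (@subset_refl _ _)) /le_trans; apply.
rewrite -(big_mkord xpredT (mu \o C)) (eq_bigr (wlength idfun \o B)).
  by apply: nneseries_lim_ge => k _ _; exact: wlength_ge0.
by move=> i _ /=; rewrite [LHS]measurable_mu_extE.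
Qed.

(** Radon-Nikodym is applied to the Stieltjes measure restricted to []a, b]], where it is finite;
    the right continuity that the measure requires comes from absolute continuity. *)
Lemma stieltjes_density (G : R -> R) (a b : R) :
  {homo G : x y / x <= y} -> list_ac xpredT G ->
  exists2 g : R -> R, mu.-integrable setT (EFin \o g) &
    forall x y, a <= x -> x <= y -> y <= b ->
      G y - G x = (\int[mu]_(t in `]x, y]) g t)%R.
Proof.
move=> Gnd Gac.
have Grc (x : R) : G @ x^'+ --> G x.
  apply/cvgrPdist_le => e e0; have [d d0 dG] := list_ac_dist Gac e0.
  near=> y; apply: dG => //; rewrite distrC gtr0_norm ?subr_gt0//.
  by near: y; exact: nbhs_right_ltDr.
pose G' : cumulative R R := HB.pack G (isCumulative.Build R _ R G Gnd Grc).
pose nu := lebesgue_stieltjes_measure G'.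
(* For [b < a] no [x <= y] fit between [a] and [b], and the claim is vacuous. *)
have [ab|ba] := leP a b; last first.
  exists (fun=> 0); first exact: integrable0.
  by move=> x y ax xy yb; move: ba; rewrite ltNge (le_trans ax)// (le_trans xy).
have mab : measurable (`]a, b]%classic : set (measurableTypeR R)) by exact: measurable_itv.
have nab : (nu `]a, b]%classic < +oo)%E by rewrite /nu stieltjes_itv// ltry.
have dom : mfrestr mab nab `<< mu.
  apply/null_content_dominatesP => A mA A0; rewrite /mfrestr /mrestr.
  have /null_content_dominatesP := @stieltjes_dominates G' Gac; apply; first exact: measurableI.
  apply/eqP; rewrite eq_le measure_ge0 andbT -A0.
  by apply: le_measure; rewrite ?inE//; apply: measurableI.
have [g [g0 gfin gint gE]] := @radon_nikodym_sigma_finite _ _ _ mu (mfrestr mab nab) dom.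
exists (fine \o g).
  by apply: eq_integrable gint => // x _ /=; rewrite fineK.
move=> x y ax xy yb; have mxy : measurable (`]x, y]%classic : set (measurableTypeR R)).
  exact: measurable_itv.
have := gE _ mxy; rewrite /= /mfrestr /mrestr setIidl; last first.
  by move=> t /=; rewrite !in_itv/= => /andP[xt ty]; rewrite (le_lt_trans ax xt) (le_trans ty yb).
rewrite stieltjes_itv// => gxy; apply/EFin_inj; rewrite -[LHS]/((G' y - G' x)%:E) gxy.
rewrite /Rintegral; under [in RHS]eq_integral do rewrite /= fineK//.
by rewrite fineK// -gxy.
Unshelve. all: by end_near. Qed.
End stieltjes_density.

(** * Primitives of integrable functions *)

Section primitive.
Context {R : realType}.
Local Notation mu := (@lebesgue_measure R).

(** Jordan decomposition: the extension [F] is the difference of its variation [V] and of [V - F].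
    Both are nondecreasing and absolutely continuous, so each has a density. *)
Lemma ac_primitive (x0 x1 : R) (f : R -> R) : x0 < x1 ->
  abs_continuous `]x0, x1[ f ->
  exists (g : R -> R) (c : R), mu.-integrable setT (EFin \o g) /\
    forall x, x0 < x < x1 -> f x = c + \int[mu]_(t in `]x0, x]) g t.
Proof.
move=> x01 /abs_continuous_list_ac /(list_ac_extension x01)[F [Fac Ff F0 F1]].
have bv := list_ac_bounded_variation Fac.
have fin x y : x <= y -> total_variation x y F \is a fin_num.
  by move=> xy; apply/bounded_variationP => //; exact: bv.
pose V x := fine (total_variation x0 (clamp x0 x1 x) F).
have Vac : list_ac xpredT V by apply: total_variation_list_ac => //; exact: ltW.
have Fclamp x : F x = F (clamp x0 x1 x).
  rewrite /clamp; have [/F1 ->|xx1] := leP x1 x; first by rewrite max_r// ltW.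
  by have [/F0|] := leP x x0.
have VF x y : x <= y -> `|F y - F x| <= V y - V x.
  move=> xy; rewrite (Fclamp x) (Fclamp y) /V.
  have /andP[cx _] := clamp_itv x (ltW x01); have cxy := clamp_le x0 x1 xy.
  rewrite (total_variationD _ cx cxy) fineD ?fin// [leRHS]addrC addKr -lee_fin fineK ?fin//.
  exact: total_variation_ge.
have Vnd : {homo V : x y / x <= y}.
  by move=> x y /VF; rewrite -subr_ge0; exact: le_trans.
have Gnd : {homo V \- F : x y / x <= y}.
  move=> x y /VF /=; rewrite ler_norml => /andP[_]; lra.
have [g1 g1i g1E] := stieltjes_density x0 x1 Vnd Vac.
have [g2 g2i g2E] := stieltjes_density x0 x1 Gnd (list_acD Vac (list_acN Fac)).
exists (g1 \- g2), (F x0); split.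
  by apply: eq_integrable (integrableB measurableT g1i g2i).
move=> x /andP[x0x xx1]; rewrite RintegralB//; last 2 first.
  by apply: integrableS g1i.
  by apply: integrableS g2i.
rewrite -(g1E x0 x (lexx _) (ltW x0x) (ltW xx1)) -(g2E x0 x (lexx _) (ltW x0x) (ltW xx1))/= -(Ff x) ?x0x//; lra.
Qed.

Lemma integral_oc_derive (x0 : R) (g : R -> R) : mu.-integrable setT (EFin \o g) ->
  {ae mu, forall x, x0 < x ->
    is_derive x 1 (fun y => \int[mu]_(t in `]x0, y]) g t) (g x)}.
Proof.
move=> gi; have loc : locally_integrable setT g by exact: open_integrable_locally openT gi.
have gi' y : mu.-integrable `]x0, y] (EFin \o g) by apply: integrableS gi.
have := @FTC1 R g (BRight x0) gi' loc; apply: filterS => [|x /= H x0x]; first exact: (ae_filter_ringOfSetsType mu).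
by have [] := H x0x; rewrite derive1E => /derivableP ? <-.
Qed.

Lemma ac_derive (x0 x1 : R) (f g : R -> R) (c : R) :
  mu.-integrable setT (EFin \o g) ->
  (forall x, x0 < x < x1 -> f x = c + \int[mu]_(t in `]x0, x]) g t) ->
  {ae mu, forall x, x0 < x < x1 -> is_derive x 1 f (g x)}.
Proof.
move=> gi fE; have := integral_oc_derive x0 gi; apply: (@filterS _ _ (ae_filter_ringOfSetsType mu)) => x H /andP[x0x xx1].
have H' : is_derive x 1 (fun y => c + \int[mu]_(t in `]x0, y]) g t) (g x).
  by have := H x0x => ?; rewrite -[g x]add0r; exact: is_deriveD.
apply: (@near_eq_is_derive _ _ _ (fun y => c + \int[mu]_(t in `]x0, y]) g t)) => //.
near=> y; apply/esym/fE; apply/andP; split; near: y.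
  exact: lt_nbhsr.
exact: lt_nbhsl.
Unshelve. all: by end_near. Qed.

(** The increments add up to at most the integral of [|g|] over the union of the intervals, which is
    small with the measure of that union. *)
Lemma integral_oc_ac (x0 : R) (g : R -> R) (D : set R) :
  mu.-integrable setT (EFin \o g) -> D `<=` [set x | x0 <= x] ->
  abs_continuous D (fun y => \int[mu]_(t in `]x0, y]) g t).
Proof.
move=> gi D0 e e0.
have [d [d0 dg]] := integral_normr_continuous gi e0.
exists d => // n a b ab tab abd.
have gA (A : set R) : measurable A -> mu.-integrable A (EFin \o g).
  by move=> mA; exact: integrableS gi.
pose I k : set R := `]a k, b k[%classic.
have mI k : measurable (I k) by exact: measurable_itv.
pose A := \big[setU/set0]_(k < n) I k.
have mA : measurable A by exact: bigsetU_measurable.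
have ndist k : `|(\int[mu]_(t in `]x0, b k]) g t) - (\int[mu]_(t in `]x0, a k]) g t)|
    <= \int[mu]_(t in I k) `|g t|.
  have [akbk abD] := ab k.
  have x0a : x0 <= a k by apply/D0/abD; rewrite /= in_itv/= lexx ltW.
  rewrite Rintegral_itvB ?bnd_simp//; [|exact: gA|exact: ltW].
  rewrite -Rintegral_itv_bndo_bndc; last exact: gA.
  by apply: le_normr_Rintegral => //; exact: gA.
have AE : \int[mu]_(t in A) `|g t| = \sum_(k < n) \int[mu]_(t in I k) `|g t|.
  rewrite /Rintegral ge0_integral_bigsetU//=.
  - rewrite -sum_fine// => k _.
    apply: integrable_fin_num; first exact: mI.
    exact: (integrable_abse (gA _ (mI k))).
  - exact: index_enum_uniq.
  - by apply: sub_trivIset tab.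
  - by have /integrable_abse/measurable_int := gA _ mA.
rewrite (le_lt_trans (ler_sum _ (fun k _ => ndist k)))// -AE; apply: dg => //.
rewrite /A measure_bigsetU_ord//= (eq_bigr (fun k => (b k - a k)%:E)).
  by rewrite sumEFin lte_fin.
move=> k _; rewrite lebesgue_measure_itv/= lte_fin.
by have [-> _] := ab k.
Qed.
End primitive.

(** * Integrals of functions that agree almost everywhere *)

Section integral_ae.
Local Open Scope ereal_scope.
Context d (T : measurableType d) (R : realType).
Variable mu : {measure set T -> \bar R}.
Import HBNNSimple.

Let ge0_le_integral_off_null (f g : T -> \bar R) (N : set T) :
  measurable N -> mu N = 0 -> (forall x, 0 <= f x) -> (forall x, 0 <= g x) ->
  (forall x, ~ N x -> f x = g x) -> \int[mu]_x f x <= \int[mu]_x g x.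
Proof.
move=> mN N0 f0 g0 fg; rewrite [leLHS]ge0_integralTE// [leRHS]ge0_integralTE//.
apply: ge_ereal_sup => _ [h /= hf <-].
(* [k] is [h] set to zero on [N]: it has the same integral, and it lies below [g] everywhere because
   [g] is nonnegative. *)
pose k := proj_nnsfun h (measurableC mN).
have kE x : ~ N x -> h x = k x by move=> Nx; rewrite /k/= mindicE mem_set// mulr1.
have kN x : N x -> k x = 0%R.
  by move=> Nx; rewrite /k/= mindicE memNset ?mulr0//=; exact/not_notP.
have -> : sintegral mu h = sintegral mu k.
  rewrite -!integralT_nnsfun; apply: ae_eq_integral => //.
  - exact/measurable_EFinP.
  - exact/measurable_EFinP.
  - exists N; split => // x /=; apply: contra_notP => Nx _.
    by congr EFin; exact: kE.
apply: ereal_sup_ubound; exists k => // x.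
have [/kN ->//|Nx] := pselect (N x).
by rewrite -fg// (le_trans _ (hf x))// lee_fin kE.
Qed.

Let integral_off_null (f g : T -> \bar R) (N : set T) :
  measurable N -> mu N = 0 ->
  (forall x, ~ N x -> f x = g x) -> \int[mu]_x f x = \int[mu]_x g x.
Proof.
move=> mN N0 fg; rewrite [LHS]integralE [RHS]integralE.
congr (_ - _); apply/eqP; rewrite eq_le; apply/andP; split;
  apply: (@ge0_le_integral_off_null _ _ N) => // x Nx;
  by rewrite ?funeposE ?funenegE fg.
Qed.

(* Unlike [ae_eq_integral], no measurability of [f] and [g] is required: a null
   set can be removed from the simple functions below [f]. *)
Lemma ae_eq_integral_gen (D : set T) (f g : T -> \bar R) :
  {ae mu, forall x, D x -> f x = g x} ->
  \int[mu]_(x in D) f x = \int[mu]_(x in D) g x.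
Proof.
move=> [N [mN N0 fgN]]; rewrite integral_mkcond [RHS]integral_mkcond.
apply: (@integral_off_null _ _ N) => // x Nx; rewrite !patchE.
case: ifPn => // /set_mem Dx.
by apply: contrapT => fgx; apply: Nx; apply: fgN => /(_ Dx).
Qed.

Lemma ae_eq_Rintegral (D : set T) (f g : T -> R) :
  {ae mu, forall x, D x -> f x = g x} ->
  (\int[mu]_(x in D) f x = \int[mu]_(x in D) g x)%R.
Proof.
move=> [N [mN N0 fg]]; congr fine; apply: ae_eq_integral_gen; exists N; split=> //.
by apply: subset_trans fg => x /=; apply: contra_not => H /H ->.
Qed.

End integral_ae.

(** * Algebra of absolutely continuous real functions *)

Section ac_calculus.
Context {R : realType}.
Local Notation mu := (@lebesgue_measure R).
Implicit Types (f g h : R -> R) (D : set R).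

(** A single comparison of increments, from which closure under sums, products and Lipschitz maps
    follows. *)
Lemma abs_continuous_le D f g (h : R -> R) (L M : R) : 0 <= L -> 0 <= M ->
  (forall x y, D x -> D y -> `|h x - h y| <= L * `|f x - f y| + M * `|g x - g y|) ->
  abs_continuous D f -> abs_continuous D g -> abs_continuous D h.
Proof.
move=> L0 M0 hfg fac gac e e0.
(* The [+ 1] keeps the divisor positive when the constant is zero. *)
have e1 : 0 < e / (2 * (L + 1)) by rewrite divr_gt0// mulr_gt0//; lra.
have e2 : 0 < e / (2 * (M + 1)) by rewrite divr_gt0// mulr_gt0//; lra.
have [d d0 df] := fac _ e1; have [d' d'0 dg] := gac _ e2.
exists (Num.min d d'); first by rewrite lt_min d0.
move=> n a b ab tab; rewrite lt_min => /andP[abd abd'].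
have := df n a b ab tab abd; have := dg n a b ab tab abd'.
rewrite !ltr_pdivlMr; [|by lra|by lra].
set F := \sum_(k < n) `|f _ - _|; set G := \sum_(k < n) `|g _ - _| => Gb Fb.
have F0 : 0 <= F by exact: sumr_ge0.
have G0 : 0 <= G by exact: sumr_ge0.
rewrite (@le_lt_trans _ _ (L * F + M * G))//; last by nra.
rewrite /F /G !mulr_sumr -big_split/=; apply: ler_sum => k _; apply: hfg.
  by have [akbk] := ab k; apply; rewrite /= in_itv/= lexx ltW.
by have [akbk] := ab k; apply; rewrite /= in_itv/= lexx ltW.
Qed.

Lemma abs_continuous_id D : abs_continuous D (@id R).
Proof.
move=> e e0; exists e => // n a b ab _; apply: le_lt_trans; apply: ler_sum => k _.
by rewrite gtr0_norm// subr_gt0; have [] := ab k.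
Qed.

Lemma abs_continuous_lipschitz D f (L : R) : 0 <= L ->
  (forall x y, D x -> D y -> `|f x - f y| <= L * `|x - y|) -> abs_continuous D f.
Proof.
move=> L0 fL.
apply: (@abs_continuous_le D id id f L 0) => //; last 2 first.
- exact: abs_continuous_id.
- exact: abs_continuous_id.
by move=> x y Dx Dy; rewrite mul0r addr0; exact: fL.
Qed.

Lemma abs_continuous_cst D (c : R) : abs_continuous D (fun=> c).
Proof.
by apply: (@abs_continuous_lipschitz _ _ 0) => // x y _ _; rewrite subrr normr0 mul0r.
Qed.

Lemma abs_continuousD D f g : abs_continuous D f -> abs_continuous D g ->
  abs_continuous D (fun x => f x + g x).
Proof.
apply: (@abs_continuous_le _ _ _ _ 1 1) => // x y _ _.
by rewrite !mul1r opprD addrACA ler_normD.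
Qed.

Lemma abs_continuousB D f g : abs_continuous D f -> abs_continuous D g ->
  abs_continuous D (fun x => f x - g x).
Proof.
apply: (@abs_continuous_le _ _ _ _ 1 1) => // x y _ _; rewrite !mul1r.
rewrite (_ : _ - _ = (f x - f y) - (g x - g y)); last by ring.
by rewrite (le_trans (ler_normD _ _))// normrN.
Qed.

Lemma abs_continuousN D f : abs_continuous D f -> abs_continuous D (fun x => - f x).
Proof.
move=> fac; apply: (@abs_continuous_le _ _ _ _ 1 0) (fac) (fac) => // x y _ _.
by rewrite mul1r mul0r addr0 -opprD normrN.
Qed.

Lemma abs_continuousM D f g (L M : R) :
  (forall x, D x -> `|f x| <= L) -> (forall x, D x -> `|g x| <= M) ->
  abs_continuous D f -> abs_continuous D g -> abs_continuous D (fun x => f x * g x).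
Proof.
(* A point of [D] shows that [L] and [M] are nonnegative; over an empty [D] the comparison of
   increments holds trivially. *)
move=> fL gM; have [[z Dz]|D0] := pselect (exists z, D z); last first.
  apply: (@abs_continuous_le _ _ _ _ 0 0) => // x y Dx; exfalso; apply: D0.
  by exists x.
apply: (@abs_continuous_le _ _ _ _ M L).
- exact: le_trans (gM _ Dz).
- exact: le_trans (fL _ Dz).
move=> x y Dx Dy; rewrite (_ : _ - _ = g x * (f x - f y) + f y * (g x - g y)); last by ring.
by rewrite (le_trans (ler_normD _ _))// !normrM lerD// ler_wpM2r// ?gM// fL.
Qed.

Lemma eq_abs_continuous D f g : (forall x, D x -> f x = g x) ->
  abs_continuous D f -> abs_continuous D g.
Proof.
move=> fg fac; apply: (@abs_continuous_le _ _ _ _ 1 0) (fac) (fac) => // x y Dx Dy.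
by rewrite mul1r mul0r addr0 !fg.
Qed.

Lemma normr_Rintegral_le_setT (g : R -> R) (D : set (measurableTypeR R)) :
  mu.-integrable setT (EFin \o g) -> measurable D ->
  `|\int[mu]_(t in D) g t| <= \int[mu]_t `|g t|.
Proof.
move=> gi mD; have giD : mu.-integrable D (EFin \o g) by apply: integrableS gi.
have := le_normr_Rintegral mD giD; move=> /le_trans; apply; apply: fine_le.
- by apply: integrable_fin_num => //; exact: (integrable_abse giD).
- by apply: integrable_fin_num => //; exact: (integrable_abse gi).
- apply: ge0_subset_integral => //=.
  by have /integrable_abse/measurable_int := gi.
Qed.

(** Supplies the bounds that the product rule asks for, read off from the representation as a
    primitive. *)
Lemma abs_continuous_bounded (x0 x1 : R) f : x0 < x1 -> abs_continuous `]x0, x1[ f ->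
  exists M, forall x, x0 < x < x1 -> `|f x| <= M.
Proof.
move=> x01 /(ac_primitive x01)[g [c [gi fE]]].
exists (`|c| + \int[mu]_t `|g t|) => x xx.
by rewrite fE// (le_trans (ler_normD _ _))// lerD// normr_Rintegral_le_setT.
Qed.

End ac_calculus.

(** * Integrals over open intervals as functions of the upper end point *)

Section integral_oo.
Context {R : realType}.
Local Notation mu := (@lebesgue_measure R).
Implicit Types (f g h : R -> R) (D : set R).

(** The maximum covers [r < p], where both domains are empty; the integral can thus be studied for
    every real [r]. *)
Lemma integral_ooE (p r : R) g : mu.-integrable setT (EFin \o g) ->
  \int[mu]_(t in `]p, r[) g t = \int[mu]_(t in `]p, Num.max p r]) g t.
Proof.
move=> gi; have [pr|rp] := leP p r.
  by rewrite Rintegral_itv_bndo_bndc//; apply: integrableS gi.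
by rewrite !set_itv_ge ?bnd_simp -?leNgt// ltW.
Qed.

Lemma integral_oo_dist (p : R) g : mu.-integrable setT (EFin \o g) ->
  forall e, 0 < e -> exists2 d, 0 < d & forall x y, `|x - y| < d ->
    `|(\int[mu]_(t in `]p, x[) g t) - (\int[mu]_(t in `]p, y[) g t)| < e.
Proof.
move=> gi e e0; have [d [d0 dg]] := integral_normr_continuous gi e0.
exists d => // x y; wlog xy : x y / y <= x => [hw|].
  have [yx|/ltW yx] := leP y x; first exact: hw.
  by move=> xyd; rewrite distrC; apply: hw => //; rewrite distrC.
rewrite (ger0_norm (_ : 0 <= x - y)) ?subr_ge0// => xyd; rewrite !integral_ooE//.
have gi' (A : set (measurableTypeR R)) : measurable A -> mu.-integrable A (EFin \o g).
  by move=> mA; exact: integrableS gi.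
have pxy : Num.max p y <= Num.max p x by rewrite ge_max !le_max lexx xy orbT.
rewrite Rintegral_itvB ?bnd_simp//; [|exact: gi'|by rewrite le_max lexx].
have := le_normr_Rintegral _ (gi' `]Num.max p y, Num.max p x]%classic _).
move=> /(_ (measurable_itv _) (measurable_itv _)) /le_lt_trans; apply.
apply: dg; first exact: measurable_itv.
rewrite [X in (X < _)%E]lebesgue_measure_itv/= lte_fin.
case: ifPn => _; rewrite ?lte_fin// (le_lt_trans _ xyd)//.
case: (leP p y) => py; case: (leP p x) => px; lra.
Qed.

Lemma integral_oo_continuous (p : R) g : mu.-integrable setT (EFin \o g) ->
  continuous (fun r => \int[mu]_(t in `]p, r[) g t).
Proof.
move=> gi x; apply/cvgrPdist_lt => e e0.
have [d d0 dg] := integral_oo_dist p gi e0.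
by exists d => // y; exact: dg.
Qed.

Lemma measurable_integral_oo (p : R) g : mu.-integrable setT (EFin \o g) ->
  measurable_fun setT (fun r => \int[mu]_(t in `]p, r[) g t).
Proof. by move=> gi; apply: continuous_measurable_fun; exact: integral_oo_continuous. Qed.

Lemma integral_oo_cvg0 (p : R) g : mu.-integrable setT (EFin \o g) ->
  \int[mu]_(t in `]p, r[) g t @[r --> p^'+] --> (0 : R).
Proof.
move=> gi; have := @integral_oo_continuous p g gi p.
rewrite /continuous_at set_itvoo0 Rintegral_set0 => H.
exact: cvg_within_filter H.
Qed.

Lemma integral_oo_ac (p q : R) g : mu.-integrable setT (EFin \o g) ->
  abs_continuous `]p, q[ (fun r => \int[mu]_(t in `]p, r[) g t).
Proof.
move=> gi; have := @integral_oc_ac R p g `]p, q[ gi; move=> H.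
apply: eq_abs_continuous (H _) => x /=; rewrite in_itv/= => /andP[/ltW px _] //.
by rewrite integral_ooE// max_r.
Qed.

Lemma integral_oo_derive (p : R) g : mu.-integrable setT (EFin \o g) ->
  {ae mu, forall x, p < x ->
    is_derive x 1 (fun y => \int[mu]_(t in `]p, y[) g t) (g x)}.
Proof.
move=> gi; have := integral_oc_derive p gi.
apply: (@filterS _ _ (ae_filter_ringOfSetsType mu)) => x H px.
apply: (@near_eq_is_derive _ _ _ (fun y => \int[mu]_(t in `]p, y]) g t)); last exact: H.
near=> y; rewrite integral_ooE// max_r//; apply/ltW; near: y; exact: lt_nbhsr.
Unshelve. all: by end_near. Qed.

(** The density given by [ac_primitive] and [g] are both derivatives of [f] almost everywhere, so
    they have the same integrals; the limit at [x0] identifies the additive constant. *)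
Lemma ac_FTC (x0 x1 : R) f g (l : R) : x0 < x1 -> abs_continuous `]x0, x1[ f ->
  {ae mu, forall x, x0 < x < x1 -> is_derive x 1 f (g x)} ->
  f x @[x --> x0^'+] --> l ->
  forall x, x0 < x < x1 -> f x = l + \int[mu]_(t in `]x0, x[) g t.
Proof.
move=> x01 /(ac_primitive x01)[h [c [hi fE]]] fg fl x xx.
have fE' y : x0 < y < x1 -> f y = c + \int[mu]_(t in `]x0, y[) h t.
  by move=> yy; rewrite fE// integral_ooE// max_r//; case/andP : yy => /ltW.
have -> : l = c.
  apply: (cvg_unique _ fl); first exact: Rhausdorff.
  have : (c + \int[mu]_(t in `]x0, y[) h t) @[y --> x0^'+] --> c + 0.
    by apply: cvgD; [exact: cvg_cst|exact: integral_oo_cvg0].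
  rewrite addr0; apply: cvg_trans; apply: near_eq_cvg.
  near=> y; apply/esym/fE'; apply/andP; split; near: y.
    exact: nbhs_right_gt.
  exact: nbhs_right_lt.
rewrite fE'//; congr (_ + _); apply: ae_eq_Rintegral.
have := ac_derive hi fE.
apply: (@filterS2 _ _ (ae_filter_ringOfSetsType mu) _ _ _ _ fg) => t h1 h2.
rewrite /= in_itv/= => /andP[x0t tx].
have tt : x0 < t < x1 by rewrite x0t (lt_trans tx)//; case/andP : xx.
by have /@derive_val <- := h2 tt; have /@derive_val <- := h1 tt.
Unshelve. all: by end_near. Qed.

Lemma integrable_bounded_mul g h (B : R) : mu.-integrable setT (EFin \o g) ->
  measurable_fun setT h -> (forall x, `|h x| <= B) ->
  mu.-integrable setT (EFin \o (fun x => g x * h x)).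
Proof.
move=> gi mh hB; have mg : measurable_fun setT g.
  by apply/measurable_EFinP; exact: measurable_int gi.
apply: (le_integrable _ _ _ (integrableZl _ B gi)) => //.
- by apply/measurable_EFinP; exact: measurable_funM.
- move=> x _; rewrite abseM /= -EFinM lee_fin normrM mulrC ler_wpM2r//.
  by rewrite (le_trans (hB x))// ler_norm.
Qed.

(* The iterated integral of [k(s_1) ... k(s_n)] over the simplex
   p < s_1 < ... < s_n < r is [M(r)^n / n!] with [M(r)] the integral of [k]. *)
Lemma integral_power (p r : R) (k : R -> R) n : p < r ->
  mu.-integrable setT (EFin \o k) ->
  let M x := \int[mu]_(t in `]p, x[) k t in
  \int[mu]_(t in `]p, r[) (k t * (M t ^+ n / n`!%:R)) = M r ^+ n.+1 / n.+1`!%:R.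
Proof.
move=> pr ki M; pose f x := M x ^+ n.+1 / n.+1`!%:R.
(* [ac_FTC] speaks of interior points, so the interval is prolonged beyond [r]. *)
have pr1 : p < r + 1 by rewrite (lt_trans pr)// ltrDl.
have MB x : `|M x| <= \int[mu]_t `|k t| by exact: normr_Rintegral_le_setT.
have Mac m : abs_continuous `]p, (r + 1)[ (fun x => M x ^+ m).
  elim: m => [|m IH]; first exact: abs_continuous_cst.
  have {1}-> : (fun x => M x ^+ m.+1) = (fun x => M x * M x ^+ m).
    by apply/funext => x; rewrite exprS.
  apply: (abs_continuousM (fun x _ => MB x)) IH.
    by move=> x _; rewrite normrX; apply: lerXn2r (MB x); rewrite nnegrE// (le_trans _ (MB x)).
  exact: integral_oo_ac.
have fac : abs_continuous `]p, (r + 1)[ f.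
  apply: (@abs_continuousM _ _ _ _ ((\int[mu]_t `|k t|) ^+ n.+1) (n.+1`!%:R^-1)) => //.
  - by move=> x _; rewrite normrX; apply: lerXn2r (MB x); rewrite nnegrE// (le_trans _ (MB x)).
  - by move=> x _; rewrite ger0_norm.
  - exact: abs_continuous_cst.
have fd : {ae mu, forall x, p < x < r + 1 -> is_derive x 1 f (k x * (M x ^+ n / n`!%:R))}.
  have := integral_oo_derive p ki.
  apply: (@filterS _ _ (ae_filter_ringOfSetsType mu)) => x H /andP[/H Hx _].
  have -> : k x * (M x ^+ n / n`!%:R) = n.+1`!%:R^-1 *: (n.+1%:R * M x ^+ n *: k x).
    rewrite factS natrM /GRing.scale/= invfM.
    have a0 : (n.+1%:R : R) != 0 by rewrite pnatr_eq0.
    have b0 : (n`!%:R : R) != 0 by rewrite pnatr_eq0 -lt0n fact_gt0.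
    move: (n.+1%:R : R) (n`!%:R : R) (M x ^+ n) (k x) a0 b0 => a b m c a0 b0.
    by field; rewrite a0 b0.
  rewrite (_ : f = (n.+1`!%:R^-1 *: (M ^+ n.+1))); last first.
    by apply/funext => y; rewrite /f fctE /GRing.scale/= mulrC.
  by apply: is_deriveZ; exact: is_deriveX.
have f0 : f x @[x --> p^'+] --> (0 : R).
  have M0 : M x @[x --> p^'+] --> (0 : R) by exact: integral_oo_cvg0.
  rewrite (_ : 0 = 0 ^+ n.+1 / n.+1`!%:R); last by rewrite expr0n/= mul0r.
  apply: cvgM; last exact: cvg_cst.
  elim: n.+1 => [|m IH]; first by under eq_fun do rewrite expr0; rewrite expr0; exact: cvg_cst.
  by under eq_fun do rewrite exprS; rewrite exprS; exact: cvgM.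
by rewrite -[RHS]/(f r) (ac_FTC pr1 fac fd f0) ?add0r// pr/= ltrDl.
Qed.

End integral_oo.

(** * Complex-valued integrals *)

Section complex_integral.
Context {R : realType}.
Local Notation mu := (@lebesgue_measure R).
Local Notation Re := (@complex.Re R).
Local Notation Im := (@complex.Im R).
Implicit Types (z w c : R[i]) (h k : R -> R[i]).

Lemma ReDE z w : Re (z + w) = Re z + Re w. Proof. by case: z w => [? ?] [? ?]. Qed.
Lemma ImDE z w : Im (z + w) = Im z + Im w. Proof. by case: z w => [? ?] [? ?]. Qed.
Lemma ReNE z : Re (- z) = - Re z. Proof. by case: z. Qed.
Lemma ImNE z : Im (- z) = - Im z. Proof. by case: z. Qed.
Lemma ReME z w : Re (z * w) = Re z * Re w - Im z * Im w.
Proof. by case: z w => [? ?] [? ?]. Qed.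
Lemma ImME z w : Im (z * w) = Re z * Im w + Im z * Re w.
Proof. by case: z w => [? ?] [? ?]. Qed.
Lemma ReJE z : Re (conjc z) = Re z. Proof. by case: z. Qed.
Lemma ImJE z : Im (conjc z) = - Im z. Proof. by case: z. Qed.

Lemma complex_eq z w : Re z = Re w -> Im z = Im w -> z = w.
Proof. by case: z w => [? ?] [? ?] /= -> ->. Qed.

(* The sum norm bounds a complex integral componentwise, with no constant. *)
Definition norm1 z := `|Re z| + `|Im z|.

Lemma norm1_ge0 z : 0 <= norm1 z. Proof. by rewrite addr_ge0. Qed.

Lemma norm1D z w : norm1 (z + w) <= norm1 z + norm1 w.
Proof.
rewrite /norm1 ReDE ImDE addrACA; exact: lerD (ler_normD _ _) (ler_normD _ _).
Qed.

Lemma norm1M z w : norm1 (z * w) <= norm1 z * norm1 w.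
Proof.
rewrite /norm1 ReME ImME (le_trans (lerD (ler_normB _ _) (ler_normD _ _)))//.
by rewrite !normrM -subr_ge0 (_ : _ - _ = 0)//; ring.
Qed.

Lemma Re_norm1 z : `|Re z| <= norm1 z. Proof. by rewrite lerDl. Qed.
Lemma Im_norm1 z : `|Im z| <= norm1 z. Proof. by rewrite lerDr. Qed.

Definition cintegrable h := mu.-integrable setT (EFin \o (Re \o h)) /\
  mu.-integrable setT (EFin \o (Im \o h)).

Definition cmeasurable h :=
  measurable_fun setT (Re \o h) /\ measurable_fun setT (Im \o h).

Lemma cintegrable_mul k h (B : R) : cintegrable k -> cmeasurable h ->
  (forall x, norm1 (h x) <= B) -> cintegrable (fun x => k x * h x).
Proof.
move=> [k1 k2] [h1 h2] hB.
have RB x : `|(Re \o h) x| <= B by exact: le_trans (Re_norm1 _) (hB x).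
have IB x : `|(Im \o h) x| <= B by exact: le_trans (Im_norm1 _) (hB x).
split.
  apply: eq_integrable (integrableB measurableT (integrable_bounded_mul k1 h1 RB)
    (integrable_bounded_mul k2 h2 IB)) => // x _ /=.
  by rewrite ReME.
apply: eq_integrable (integrableD measurableT (integrable_bounded_mul k1 h2 IB)
  (integrable_bounded_mul k2 h1 RB)) => // x _ /=.
by rewrite ImME.
Qed.

Lemma cintegralZ (D : set (measurableTypeR R)) c h : measurable D -> cintegrable h ->
  cintegral D (fun s => c * h s) = c * cintegral D h.
Proof.
move=> mD [h1 h2].
have h1D : mu.-integrable D (EFin \o (Re \o h)) by apply: integrableS h1.
have h2D : mu.-integrable D (EFin \o (Im \o h)) by apply: integrableS h2.
have Z (a : R) (f : R -> R) : mu.-integrable D (EFin \o f) ->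
    mu.-integrable D (EFin \o (fun x => a * f x)).
  by move=> fi; apply: eq_integrable (integrableZl mD a fi) => // x _.
apply: complex_eq; rewrite ?ReME ?ImME /=.
  under eq_Rintegral do rewrite ReME.
  by rewrite RintegralB//; [rewrite !RintegralZl|exact: Z|exact: Z].
under eq_Rintegral do rewrite ImME.
by rewrite RintegralD//; [rewrite !RintegralZl|exact: Z|exact: Z].
Qed.

Lemma cintegralD (D : set (measurableTypeR R)) h k : measurable D ->
  cintegrable h -> cintegrable k ->
  cintegral D (fun s => h s + k s) = cintegral D h + cintegral D k.
Proof.
move=> mD [h1 h2] [k1 k2]; apply: complex_eq; rewrite ?ReDE ?ImDE /=.
  by under eq_Rintegral do rewrite ReDE; rewrite RintegralD//;
    [apply: integrableS h1|apply: integrableS k1].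
by under eq_Rintegral do rewrite ImDE; rewrite RintegralD//;
  [apply: integrableS h2|apply: integrableS k2].
Qed.

Lemma cintegralJ (D : set (measurableTypeR R)) h : measurable D -> cintegrable h ->
  cintegral D (fun s => conjc (h s)) = conjc (cintegral D h).
Proof.
move=> mD [h1 h2]; apply: complex_eq; rewrite ?ReJE ?ImJE /=.
  by under eq_Rintegral do rewrite ReJE.
under eq_Rintegral do rewrite ImJE -mulN1r.
by rewrite RintegralZl ?mulN1r//; apply: integrableS h2.
Qed.

Lemma cintegrable_norm1 h : cintegrable h -> mu.-integrable setT (EFin \o (norm1 \o h)).
Proof.
move=> [h1 h2]; apply: eq_integrable (integrableD measurableT (integrable_norm h1)
  (integrable_norm h2)) => // x _ /=.
Qed.

Lemma norm1_cintegral (D : set (measurableTypeR R)) h : measurable D -> cintegrable h ->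
  norm1 (cintegral D h) <= \int[mu]_(t in D) norm1 (h t).
Proof.
move=> mD [h1 h2].
have h1D : mu.-integrable D (EFin \o (Re \o h)) by apply: integrableS h1.
have h2D : mu.-integrable D (EFin \o (Im \o h)) by apply: integrableS h2.
rewrite RintegralD//; [|exact: integrable_norm|exact: integrable_norm].
exact: lerD (le_normr_Rintegral mD h1D) (le_normr_Rintegral mD h2D).
Qed.

Lemma cintegral_ae (D : set (measurableTypeR R)) h k :
  {ae mu, forall x, D x -> h x = k x} -> cintegral D h = cintegral D k.
Proof.
move=> hk; rewrite /cintegral; congr Complex; apply: ae_eq_Rintegral;
  by apply: (@filterS _ _ (ae_filter_ringOfSetsType mu) _ _ _ hk) => x H /H ->.
Qed.

Lemma cmeasurable_cintegral (p : R) h : cintegrable h ->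
  cmeasurable (fun r => cintegral `]p, r[ h).
Proof. by move=> [h1 h2]; split; exact: measurable_integral_oo. Qed.

(** The point $e^{it}$ of the unit circle; at real frequencies every exponential of the series has
    this form. *)
Definition phase (t : R) : R[i] := Complex (cos t) (sin t).

Lemma phaseD s t : phase (s + t) = phase s * phase t.
Proof. by apply: complex_eq; rewrite ?ReME ?ImME /= ?cosD ?sinD// addrC [X in X + _]mulrC mulrC. Qed.

Lemma phaseN t : phase (- t) = conjc (phase t).
Proof. by rewrite /phase cosN sinN. Qed.

Lemma norm1_phase t : norm1 (phase t) <= 2.
Proof.
by rewrite /norm1/= (_ : 2 = 1 + 1)// lerD// ler_norml ?cos_geN1 ?cos_le1 ?sin_geN1 ?sin_le1.
Qed.

Lemma cexp_imaginary z (t : R) : Re z = 0 -> Im z = t -> cexp z = phase t.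
Proof. by move=> z0 zt; rewrite /cexp z0 zt expR0; exact: mul1r. Qed.

Lemma cmeasurable_phase (f : R -> R) : continuous f -> cmeasurable (phase \o f).
Proof.
move=> fc; split; apply: continuous_measurable_fun => x.
  by apply: (@continuous_comp _ _ _ f cos); [exact: fc|exact: continuous_cos].
by apply: (@continuous_comp _ _ _ f sin); [exact: fc|exact: continuous_sin].
Qed.

End complex_integral.

(** * The harmonic exponential *)

Section harmonic_terms.
Local Open Scope complex_scope.
Context {R : realType}.
Local Notation mu := (@lebesgue_measure R).
Local Notation Re := (@complex.Re R).
Local Notation Im := (@complex.Im R).

(** The steps of the chain from [p] through [u] to [s] are shared alternately between the two values
    of [kappa], and together they telescope to [s - p]. [T n] is the value on the prefix of length
    [n]. *)
Lemma kappa_rcons (p : R) (u : seq R) (s : R) :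
  kappa p (rcons u s) = (s - p) - kappa p u.
Proof.
pose f i := nth 0 (p :: rcons u s) i.
pose T n := \sum_(k < uphalf n) (f (n - k.*2)%N - f (n - k.*2.+1)%N).
have TS n : T n.+2 = f n.+2 - f n.+1 + T n by rewrite /T /= big_ord_recl.
have Tsum n : T n.+1 + T n = f n.+1 - f 0%N.
  elim: n => [|n IH]; first by rewrite /T big_ord0 big_ord1/= addr0.
  by rewrite TS addrAC -addrA IH addrACA addrA; ring.
have -> : kappa p (rcons u s) = T (size u).+1 by rewrite /kappa size_rcons.
have -> : kappa p u = T (size u).
  apply: eq_bigr => k _; congr (_ - _); rewrite /f -rcons_cons nth_rcons/= ltnS leq_subr//.
have <- : f (size u).+1 = s by rewrite /f/= nth_rcons ltnn eqxx.
by rewrite -[X in _ - X - _]/(f 0%N) -Tsum addrK.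
Qed.

(** An arbitrary weight [K] lets the induction absorb the outermost variable and its factor; the
    bound [q] stays fixed since inner limits only decrease. *)
Lemma simplex_integral_ae (q p : R) (alpha g : R -> R) :
  {ae mu, forall t, p < t < q -> alpha t = g t} ->
  forall j r (K : seq R -> R[i]), r <= q ->
  simplex_integral j p r (fun s => K s * (\prod_(t <- s) alpha t)%:C) =
  simplex_integral j p r (fun s => K s * (\prod_(t <- s) g t)%:C).
Proof.
move=> ag; elim=> [|j IH] r K rq /=; first by rewrite !big_nil.
apply: cintegral_ae.
apply: (@filterS _ _ (ae_filter_ringOfSetsType mu) _ _ _ ag) => s ags.
rewrite /= in_itv/= => /andP[ps sr].
have sq : s <= q by rewrite (le_trans (ltW sr)).
have E (a : R -> R) : (fun u => K (rcons u s) * (\prod_(t <- rcons u s) a t)%:C) =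
    (fun u => (K (rcons u s) * (a s)%:C) * (\prod_(t <- u) a t)%:C).
  by apply/funext => u; rewrite big_rcons/= rmorphM/=; ring.
by rewrite !E IH// ags// ps (lt_le_trans sr).
Qed.

(** What the outermost variable [s] contributes to a term once [kappa_rcons] has split off
    [s - p]. *)
Definition kern (g : R -> R) (p sigma s : R) : R[i] :=
  (g s)%:C * phase (2 * sigma * (s - p)).

(* As [kappa p (rcons u s) = (s - p) - kappa p u], integrating out the first
   [j'] variables gives the term of order [j'] at the opposite frequency. *)
Fixpoint eterm (g : R -> R) (p sigma : R) j (r : R) : R[i] :=
  if j is j'.+1 then
    cintegral `]p, r[ (fun s => kern g p sigma s * eterm g p (- sigma) j' s)
  else 1.

(* The factor 2 is a bound on the [norm1] of a phase. *)
Definition mass (g : R -> R) (p r : R) : R := \int[mu]_(t in `]p, r[) (2 * `|g t|).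

Section terms.
Variables (g : R -> R) (p : R).
Hypothesis gi : mu.-integrable setT (EFin \o g).

Let gi2 : mu.-integrable setT (EFin \o (fun t => 2 * `|g t|)).
Proof. by apply: eq_integrable (integrableZl measurableT 2 (integrable_norm gi)). Qed.

Lemma cintegrable_kern sigma : cintegrable (kern g p sigma).
Proof.
have gci : cintegrable (fun s => (g s)%:C).
  by split => //; exact: integrable0.
apply: (@cintegrable_mul _ _ _ 2 gci) => [|x]; last exact: norm1_phase.
apply: (@cmeasurable_phase _ (fun s => 2 * sigma * (s - p))) => x.
by apply: cvgM; [exact: cvg_cst|apply: cvgB; [exact: cvg_id|exact: cvg_cst]].
Qed.

Lemma norm1_kern sigma s : norm1 (kern g p sigma s) <= 2 * `|g s|.
Proof.
rewrite (le_trans (norm1M _ _))// mulrC ler_pM ?norm1_ge0 ?norm1_phase//.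
by rewrite /norm1/= normr0 addr0.
Qed.

Lemma mass_ge0 r : 0 <= mass g p r.
Proof. by apply: Rintegral_ge0 => t _; rewrite mulr_ge0. Qed.

Lemma massT r : mass g p r <= \int[mu]_t (2 * `|g t|).
Proof.
have := normr_Rintegral_le_setT gi2 (measurable_itv `]p, r[).
rewrite ger0_norm ?mass_ge0// => /le_trans; apply.
by rewrite le_eqVlt; apply/orP; left; apply/eqP; apply: eq_Rintegral => t _; rewrite ger0_norm ?mulr_ge0.
Qed.

(** The frequency is quantified inside the induction because the recursion changes its sign.
    Measurability and bound go together: both are needed for the next integrand to be integrable. *)
Lemma eterm_bound j : forall sigma, cmeasurable (eterm g p sigma j) /\
  (forall r, norm1 (eterm g p sigma j r) <= 2 * mass g p r ^+ j / j`!%:R).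
Proof.
elim: j => [|j IH] sigma.
  split; first by split; exact: measurable_cst.
  move=> r; rewrite expr0 fact0 divr1 mulr1 /norm1/= normr1 normr0 addr0.
  by rewrite ler1n.
have [mE bE] := IH (- sigma).
(* Integrability of the product needs a bound uniform in [r], hence the mass of the whole line. *)
pose B := 2 * (\int[mu]_t (2 * `|g t|)) ^+ j / j`!%:R.
have EB r : norm1 (eterm g p (- sigma) j r) <= B.
  rewrite (le_trans (bE r))// /B -!mulrA ler_wpM2l// ler_wpM2r// lerXn2r ?nnegrE ?mass_ge0 ?massT//.
  exact: le_trans (mass_ge0 p) (massT p).
have ci : cintegrable (fun s => kern g p sigma s * eterm g p (- sigma) j s).
  exact: cintegrable_mul (cintegrable_kern _) mE EB.
split; first exact: cmeasurable_cintegral.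
move=> r /=; have mpr : measurable (`]p, r[%classic : set (measurableTypeR R)).
  exact: measurable_itv.
rewrite (le_trans (norm1_cintegral mpr ci))//.
have [pr|rp] := ltP p r; last first.
  by rewrite set_itv_ge ?bnd_simp -?leNgt// Rintegral_set0 mulr_ge0// mulr_ge0// exprn_ge0// mass_ge0.
have Mi : mu.-integrable `]p, r[ (EFin \o (fun t => 2 * `|g t| * (mass g p t ^+ j / j`!%:R))).
  apply: integrableS (measurableT) mpr (@subsetT _ _) _.
  apply: (@integrable_bounded_mul _ _ _ ((\int[mu]_t (2 * `|g t|)) ^+ j / j`!%:R) gi2).
    apply: measurable_funM => //; apply: measurable_funX.
    exact: measurable_integral_oo gi2.
  move=> t; rewrite ger0_norm; last by rewrite mulr_ge0// exprn_ge0// mass_ge0.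
  rewrite ler_wpM2r// lerXn2r ?nnegrE ?mass_ge0 ?massT//.
  exact: le_trans (mass_ge0 p) (massT p).
(* With the density [2 * |g|], [integral_power] raises the exponent and the factorial by one. *)
rewrite -mulrA -(integral_power j pr gi2) -RintegralZl//.
apply: le_Rintegral => //.
- by apply: integrableS (cintegrable_norm1 ci).
- by apply: eq_integrable (integrableZl mpr 2 Mi).
move=> s _; rewrite (le_trans (norm1M _ _))//.
rewrite mulrCA [X in _ <= _ * X]mulrA.
by apply: ler_pM; rewrite ?norm1_ge0 ?norm1_kern//; exact: bE.
Qed.

End terms.
End harmonic_terms.

Section harmonic_series.
Context {R : realType}.
Local Open Scope complex_scope.
Local Notation mu := (@lebesgue_measure R).
Local Notation Re := (@complex.Re R).
Local Notation Im := (@complex.Im R).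

Lemma normc_le_norm1 (z : R[i]) : `|z| <= (norm1 z)%:C.
Proof.
rewrite normc_def lecR -[leRHS]ger0_norm ?norm1_ge0// -sqrtr_sqr ler_wsqrtr// /norm1.
rewrite sqrrD !real_normK ?num_real// addrAC lerDl mulrn_wge0// mulr_ge0//.
Qed.

Lemma gtc0_real (e : R[i]) : 0 < e -> exists2 e' : R, 0 < e' & e = e'%:C.
Proof.
by case: e => [a b]; rewrite ltcE/= => /andP[/eqP -> a0]; exists a.
Qed.

Lemma complex_cvg (T : Type) (F : set_system T) {FF : Filter F} (u : T -> R[i]) (l : R[i]) :
  (Re (u x) @[x --> F] --> Re l) -> (Im (u x) @[x --> F] --> Im l) ->
  u x @[x --> F] --> l.
Proof.
move=> ur ui; apply/cvgrPdist_lt => e /gtc0_real[e' e'0 ->].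
have e20 : 0 < e' / 2 by rewrite divr_gt0.
move/cvgrPdist_lt : ur => /(_ _ e20) ur; move/cvgrPdist_lt : ui => /(_ _ e20) ui.
near=> x; rewrite (le_lt_trans (normc_le_norm1 _))// ltcR (splitr e') ltrD//.
  by rewrite ReDE ReNE; near: x.
by rewrite ImDE ImNE; near: x.
Unshelve. all: by end_near. Qed.

Lemma Rintegral_dominated_cvg (D : set (measurableTypeR R)) (u : nat -> R -> R)
    (f G : R -> R) : measurable D -> (forall n, measurable_fun setT (u n)) ->
  (forall x, u n x @[n --> \oo] --> f x) -> mu.-integrable setT (EFin \o G) ->
  (forall n x, `|u n x| <= G x) ->
  \int[mu]_(t in D) u n t @[n --> \oo] --> \int[mu]_(t in D) f t.
Proof.
move=> mD mu_ uf Gi uG.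
have mf : measurable_fun setT f by apply: (measurable_fun_cvg mu_) => x _; exact: uf.
have GD : mu.-integrable D (EFin \o G) by apply: integrableS Gi.
have fG x : `|f x| <= G x.
  have H : `|u n x| @[n --> \oo] --> `|f x| by apply: cvg_norm; exact: uf.
  move: H => /(@ler_cvg_to _ _ _ _ _ (cst (G x)) _ (G x)); apply; first exact: cvg_cst.
  exact: nearW.
have int (h : R -> R) : measurable_fun setT h -> (forall x, `|h x| <= G x) ->
    mu.-integrable D (EFin \o h).
  move=> mh hG; apply: (le_integrable mD _ _ GD).
    by apply/measurable_EFinP; exact: measurable_funTS.
  by move=> x _ /=; rewrite lee_fin (le_trans (hG x))// ler_norm.
have fi := integrable_fin_num mD (int _ mf fG).
have H : (\int[mu]_(x in D) (u n x)%:E)%E @[n --> \oo] --> (\int[mu]_(x in D) (f x)%:E)%E.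
  apply: (@dominated_cvg _ _ _ mu D mD (fun n => EFin \o u n) (EFin \o f) (EFin \o G)).
  - move=> n; have : measurable_fun D (u n) by apply: measurable_funTS; exact: mu_.
    by move/measurable_EFinP.
  - by move=> x _; apply: cvg_EFin; [by apply: nearW|exact: uf].
  - by [].
  - exact: GD.
  - by move=> n x _ /=; rewrite lee_fin.
by apply: fine_cvg; rewrite fineK.
Qed.

Section terms.
Variables (g : R -> R) (p : R).
Hypothesis gi : mu.-integrable setT (EFin \o g).

Lemma eterm_bounded sigma j : exists B, forall r, norm1 (eterm g p sigma j r) <= B.
Proof.
have [_ b] := eterm_bound p gi j sigma.
exists (2 * (\int[mu]_t (2 * `|g t|)) ^+ j / j`!%:R) => r.
rewrite (le_trans (b r))// -!mulrA ler_wpM2l// ler_wpM2r// lerXn2r ?nnegrE ?mass_ge0 ?massT//.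
exact: le_trans (mass_ge0 g p p) (massT p gi p).
Qed.

Lemma cintegrable_kern_eterm sigma tau j :
  cintegrable (fun s => kern g p sigma s * eterm g p tau j s).
Proof.
have [B EB] := eterm_bounded tau j; have [mE _] := eterm_bound p gi j tau.
exact: cintegrable_mul (cintegrable_kern p gi _) mE EB.
Qed.

(** The constant [c] carries the induction: for the inner integrals the outer factor [kern] is
    constant, and it is absorbed into [c]. *)
Lemma simplex_integral_eterm j : forall r (sigma : R) c,
  simplex_integral j p r (fun u => c *
    (cexp (2 * 'i * sigma%:C * (kappa p u)%:C) * (\prod_(t <- u) g t)%:C)) =
  c * eterm g p sigma j r.
Proof.
have cexpE (sigma x : R) : cexp (2 * 'i * sigma%:C * x%:C) = phase (2 * sigma * x).
  apply: cexp_imaginary; rewrite !(ReME, ImME)/=; ring.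
elim: j => [|j IH] r sigma c /=.
  by rewrite cexpE big_nil /kappa big_ord0 mulr0 /phase cos0 sin0 !mulr1.
rewrite -cintegralZ; [|exact: measurable_itv|exact: cintegrable_kern_eterm].
congr (cintegral _ _); apply/funext => s; rewrite mulrA -IH; congr (simplex_integral _ _ _ _).
apply/funext => u; rewrite !cexpE kappa_rcons big_rcons/= rmorphM/= /kern.
(* [kappa p u] enters [kappa_rcons] with a minus sign, which is moved onto the frequency. *)
rewrite (_ : 2 * sigma * _ = 2 * sigma * (s - p) + 2 * - sigma * kappa p u); last by ring.
by rewrite phaseD; ring.
Qed.

Lemma kernJ sigma s : kern g p (- sigma) s = conjc (kern g p sigma s).
Proof.
rewrite /kern (_ : 2 * - sigma * (s - p) = - (2 * sigma * (s - p))); last by ring.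
rewrite phaseN; apply: complex_eq; rewrite ?ReJE ?ImJE !(ReME, ImME, ReJE, ImJE)/=; ring.
Qed.

(** As [g] is real, conjugation affects the phases only and amounts to reversing the frequency. *)
Lemma etermJ j : forall r sigma, eterm g p (- sigma) j r = conjc (eterm g p sigma j r).
Proof.
elim: j => [|j IH] r sigma; first by apply: complex_eq; rewrite /= ?oppr0.
rewrite -[eterm g p sigma _ r]/(cintegral _ (fun s => kern g p sigma s * eterm g p (- sigma) j s)).
rewrite -cintegralJ; [|exact: measurable_itv|exact: cintegrable_kern_eterm].
congr (cintegral _ _); apply/funext => s; rewrite opprK rmorphM/= -/(conjc _) IH conjcK.
by rewrite kernJ.
Qed.

End terms.
End harmonic_series.

Section harmonic_sum.
Context {R : realType}.
Local Open Scope complex_scope.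
Local Notation mu := (@lebesgue_measure R).
Local Notation Re := (@complex.Re R).
Local Notation Im := (@complex.Im R).
Variables (g : R -> R) (p : R).
Hypothesis gi : mu.-integrable setT (EFin \o g).

Let S (sigma : R) n r := \sum_(0 <= j < n) eterm g p sigma j r.

Let ReS sigma n r : Re (S sigma n r) = series (fun j => Re (eterm g p sigma j r)) n.
Proof. exact: (big_morph Re ReDE erefl). Qed.

Let ImS sigma n r : Im (S sigma n r) = series (fun j => Im (eterm g p sigma j r)) n.
Proof. exact: (big_morph Im ImDE erefl). Qed.

(** The series including its term of order 0, assembled from two real limits so that real
    convergence results apply. *)
Definition hsum (sigma r : R) : R[i] :=
  Complex (limn (series (fun j => Re (eterm g p sigma j r))))
          (limn (series (fun j => Im (eterm g p sigma j r)))).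

Let series_cvg r (u : nat -> R) :
  (forall j, `|u j| <= 2 * mass g p r ^+ j / j`!%:R) -> cvgn (series u).
Proof.
move=> ub; apply: normed_cvg.
apply: (@series_le_cvg _ _ (fun j => 2 * exp_coeff (mass g p r) j)) => //.
- by move=> n; exact: normr_ge0.
- by move=> n; apply: mulr_ge0 => //; apply: exp_coeff_ge0; exact: mass_ge0.
- by move=> n /=; rewrite (le_trans (ub n))// mulrA.
- by apply: is_cvg_seriesZ; exact: is_cvg_series_exp_coeff.
Qed.

Let ReS_cvg sigma r : Re (S sigma n r) @[n --> \oo] --> Re (hsum sigma r).
Proof.
under eq_fun do rewrite ReS; apply: (@series_cvg r) => j.
by have [_ b] := eterm_bound p gi j sigma; exact: le_trans (Re_norm1 _) (b r).
Qed.

Let ImS_cvg sigma r : Im (S sigma n r) @[n --> \oo] --> Im (hsum sigma r).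
Proof.
under eq_fun do rewrite ImS; apply: (@series_cvg r) => j.
by have [_ b] := eterm_bound p gi j sigma; exact: le_trans (Im_norm1 _) (b r).
Qed.

(** Twice the exponential of the mass of the whole line: a bound for partial sums that is uniform in
    [sigma], [n] and [r], as dominated convergence requires. *)
Let B := 2 * limn (series (exp_coeff (\int[mu]_t (2 * `|g t|)))).

Let S_bound sigma n r : norm1 (S sigma n r) <= B.
Proof.
pose M := \int[mu]_t (2 * `|g t|); rewrite /B -/M.
have M0 : 0 <= M by exact: le_trans (mass_ge0 g p p) (massT p gi p).
apply: (@le_trans _ _ (2 * series (exp_coeff M) n)).
  rewrite /S /series/= mulr_sumr; elim/big_ind2 : _ => //.
  - by rewrite /norm1/= normr0 addr0.
  - by move=> x1 x2 y1 y2 h1 h2; exact: le_trans (norm1D _ _) (lerD h1 h2).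
  - move=> j _; have [_ b] := eterm_bound p gi j sigma; rewrite (le_trans (b r))// -!mulrA.
    by rewrite ler_wpM2l// ler_wpM2r// lerXn2r ?nnegrE ?mass_ge0 ?massT.
rewrite ler_wpM2l//; apply: nondecreasing_cvgn_le; last exact: is_cvg_series_exp_coeff.
by apply: nondecreasing_series => k _ _; exact: exp_coeff_ge0.
Qed.

Let S_measurable sigma n : cmeasurable (S sigma n).
Proof.
split; [under [X in measurable_fun _ X]eq_fun do rewrite /= ReS|
        under [X in measurable_fun _ X]eq_fun do rewrite /= ImS];
  apply: measurable_sum => j; by have [[]] := eterm_bound p gi j sigma.
Qed.

Lemma hsum_bound sigma r : norm1 (hsum sigma r) <= B.
Proof.
have H : norm1 (S sigma n r) @[n --> \oo] --> norm1 (hsum sigma r).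
  by apply: cvgD; apply: cvg_norm; [exact: ReS_cvg|exact: ImS_cvg].
move: H => /(@ler_cvg_to _ _ _ _ _ (cst B) _ B); apply; first exact: cvg_cst.
by apply: nearW => n; exact: S_bound.
Qed.

Lemma hsum_measurable sigma : cmeasurable (hsum sigma).
Proof.
split.
  apply: (@measurable_fun_cvg _ _ _ _ (fun n => Re \o S sigma n)) => [n|x _].
    by have [] := S_measurable sigma n.
  exact: ReS_cvg.
apply: (@measurable_fun_cvg _ _ _ _ (fun n => Im \o S sigma n)) => [n|x _].
  by have [] := S_measurable sigma n.
exact: ImS_cvg.
Qed.

Lemma cintegrable_kern_hsum sigma tau :
  cintegrable (fun s => kern g p sigma s * hsum tau s).
Proof.
exact: cintegrable_mul (cintegrable_kern p gi _) (hsum_measurable _) (hsum_bound _).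
Qed.

Let S_rec sigma n r : S sigma n.+1 r =
  1 + cintegral `]p, r[ (fun s => kern g p sigma s * S (- sigma) n s).
Proof.
rewrite /S big_nat_recl//; congr (_ + _).
elim: n => [|n IH].
  rewrite big_nil; under [X in cintegral _ X]eq_fun do rewrite big_nil mulr0.
  by apply: complex_eq; rewrite /= /Rintegral integral0.
rewrite big_nat_recr//= IH -cintegralD; [|exact: measurable_itv| |exact: cintegrable_kern_eterm].
  by congr (cintegral _ _); apply/funext => s; rewrite big_nat_recr//= mulrDr.
exact: cintegrable_mul (cintegrable_kern p gi _) (S_measurable _ _) (S_bound _ _).
Qed.

(** The limit of the recursion [S_rec] between partial sums, by dominated convergence with
    [B * norm1 (kern g p sigma s)] as majorant. *)
Lemma hsum_integral sigma r : hsum sigma r =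
  1 + cintegral `]p, r[ (fun s => kern g p sigma s * hsum (- sigma) s).
Proof.
have mpr : measurable (`]p, r[%classic : set (measurableTypeR R)) by exact: measurable_itv.
have Ki := cintegrable_norm1 (cintegrable_kern p gi sigma).
have KBi : mu.-integrable setT (EFin \o (fun s => B * norm1 (kern g p sigma s))).
  by apply: eq_integrable (integrableZl measurableT B Ki).
have Sb n s : norm1 (kern g p sigma s * S (- sigma) n s) <= B * norm1 (kern g p sigma s).
  by rewrite (le_trans (norm1M _ _))// mulrC ler_wpM2r ?norm1_ge0.
have Sm n : cmeasurable (fun s => kern g p sigma s * S (- sigma) n s).
  have [h1 h2] := cintegrable_mul (cintegrable_kern p gi sigma) (S_measurable (- sigma) n) (S_bound (- sigma) n).
  by split; apply/measurable_EFinP; [exact: measurable_int h1|exact: measurable_int h2].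
have KS_Re s : Re (kern g p sigma s * S (- sigma) n s) @[n --> \oo] -->
    Re (kern g p sigma s * hsum (- sigma) s).
  rewrite ReME; under eq_fun do rewrite ReME.
  by apply: cvgB; apply: cvgM; [exact: cvg_cst|exact: ReS_cvg|exact: cvg_cst|exact: ImS_cvg].
have KS_Im s : Im (kern g p sigma s * S (- sigma) n s) @[n --> \oo] -->
    Im (kern g p sigma s * hsum (- sigma) s).
  rewrite ImME; under eq_fun do rewrite ImME.
  by apply: cvgD; apply: cvgM; [exact: cvg_cst|exact: ImS_cvg|exact: cvg_cst|exact: ReS_cvg].
apply: complex_eq; rewrite ?ReDE ?ImDE.
  have H : Re (S sigma n r) @[n --> \oo] -->
      Re 1 + Re (cintegral `]p, r[ (fun s => kern g p sigma s * hsum (- sigma) s)).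
    rewrite -cvg_shiftS /=; under eq_fun do rewrite S_rec ReDE.
    apply: cvgD; first exact: cvg_cst.
    apply: (Rintegral_dominated_cvg mpr _ KS_Re KBi) => [n|n s]; first by have [] := Sm n.
    exact: le_trans (Re_norm1 _) (Sb n s).
  exact: (cvg_unique (@Rhausdorff R) (@ReS_cvg sigma r) H).
have H : Im (S sigma n r) @[n --> \oo] -->
    Im 1 + Im (cintegral `]p, r[ (fun s => kern g p sigma s * hsum (- sigma) s)).
  rewrite -cvg_shiftS /=; under eq_fun do rewrite S_rec ImDE.
  apply: cvgD; first exact: cvg_cst.
  apply: (Rintegral_dominated_cvg mpr _ KS_Im KBi) => [n|n s]; first by have [] := Sm n.
  exact: le_trans (Im_norm1 _) (Sb n s).
exact: (cvg_unique (@Rhausdorff R) (@ImS_cvg sigma r) H).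
Qed.

Lemma hsumJ sigma r : hsum (- sigma) r = conjc (hsum sigma r).
Proof.
have SJ n : S (- sigma) n r = conjc (S sigma n r).
  by rewrite /S (rmorph_sum (@conjc R)); apply: eq_bigr => j _; exact: etermJ.
apply: complex_eq; rewrite ?ReJE ?ImJE.
  have H : Re (S (- sigma) n r) @[n --> \oo] --> Re (hsum sigma r).
    by under eq_fun do rewrite SJ ReJE; exact: ReS_cvg.
  exact: (cvg_unique (@Rhausdorff R) (@ReS_cvg (- sigma) r) H).
have H : Im (S (- sigma) n r) @[n --> \oo] --> - Im (hsum sigma r).
  by under eq_fun do rewrite SJ ImJE; apply: cvgN; exact: ImS_cvg.
exact: (cvg_unique (@Rhausdorff R) (@ImS_cvg (- sigma) r) H).
Qed.

Lemma harm_exp_hsum (sigma r : R) : harm_exp p r g sigma%:C = hsum sigma r.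
Proof.
rewrite /harm_exp.
have termE j : simplex_integral j p r (fun s =>
    cexp (2 * 'i%C * sigma%:C * (kappa p s)%:C) * (\prod_(t <- s) g t)%:C) = eterm g p sigma j r.
  rewrite -[RHS]mul1r -(simplex_integral_eterm p gi); congr (simplex_integral _ _ _ _).
  by apply/funext => s; rewrite mul1r.
have : \sum_(1 <= j < n) eterm g p sigma j r @[n --> \oo] --> hsum sigma r - 1.
  (* The series in [harm_exp] starts at order 1; its separate summand 1 is the term of order 0 in
     [hsum]. *)
  have SE n : (0 < n)%N -> \sum_(1 <= j < n) eterm g p sigma j r = S sigma n r - 1.
    by move=> n0; rewrite /S [in RHS]big_ltn//= addrC addKr.
  apply: complex_cvg.
    have : Re (S sigma n r) - 1 @[n --> \oo] --> Re (hsum sigma r) - 1.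
      by apply: cvgB; [exact: ReS_cvg|exact: cvg_cst].
    rewrite ReDE ReNE; apply: cvg_trans; apply: near_eq_cvg; near=> n.
    by rewrite SE ?ReDE ?ReNE//; near: n; exact: nbhs_infty_gt.
  rewrite ImDE ImNE /= oppr0 addr0; have := @ImS_cvg sigma r.
  apply: cvg_trans; apply: near_eq_cvg; near=> n.
  by rewrite SE ?ImDE ?ImNE ?oppr0 ?addr0 ?subr0//; near: n; exact: nbhs_infty_gt.
under [X in limn X]eq_fun do under eq_bigr do rewrite termE.
move/cvg_lim => ->; first by rewrite addrC subrK.
exact: norm_hausdorff.
Unshelve. all: by end_near. Qed.

End harmonic_sum.

(** * Calculus of complex functions of a real variable *)

Section complex_ac.
Context {R : realType}.
Local Open Scope complex_scope.
Local Notation mu := (@lebesgue_measure R).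
Local Notation Re := (@complex.Re R).
Local Notation Im := (@complex.Im R).
Implicit Types (f h : R -> R[i]).

(** This notion and the next two are componentwise, so that real results apply;
    [abs_continuous_vec], [has_derivative_vec] and [cvg_vec] relate them to the vector notions. *)
Definition cac (D : set R) f := abs_continuous D (Re \o f) /\ abs_continuous D (Im \o f).

Definition cder f (x : R) (l : R[i]) :=
  is_derive x 1 (Re \o f) (Re l) /\ is_derive x 1 (Im \o f) (Im l).

Definition ccvg (T : Type) (F : set_system T) (f : T -> R[i]) (l : R[i]) :=
  (Re (f x) @[x --> F] --> Re l) /\ (Im (f x) @[x --> F] --> Im l).

Lemma eq_cac D f h : (forall x, D x -> f x = h x) -> cac D f -> cac D h.
Proof.
by move=> fh [f1 f2]; split; [apply: eq_abs_continuous f1|apply: eq_abs_continuous f2] => x Dx /=; rewrite fh.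
Qed.

Lemma cac_cst D (c : R[i]) : cac D (fun=> c).
Proof. by split; exact: abs_continuous_cst. Qed.

Lemma cacD D f h : cac D f -> cac D h -> cac D (fun x => f x + h x).
Proof.
move=> [f1 f2] [h1 h2]; split.
  by apply: eq_abs_continuous (abs_continuousD f1 h1) => x _ /=; rewrite ReDE.
by apply: eq_abs_continuous (abs_continuousD f2 h2) => x _ /=; rewrite ImDE.
Qed.

Lemma cacN D f : cac D f -> cac D (fun x => - f x).
Proof.
move=> [f1 f2]; split.
  by apply: eq_abs_continuous (abs_continuousN f1) => x _ /=; rewrite ReNE.
by apply: eq_abs_continuous (abs_continuousN f2) => x _ /=; rewrite ImNE.
Qed.

Lemma cacJ D f : cac D f -> cac D (fun x => conjc (f x)).
Proof.
move=> [f1 f2]; split.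
  by apply: eq_abs_continuous f1 => x _ /=; rewrite ReJE.
by apply: eq_abs_continuous (abs_continuousN f2) => x _ /=; rewrite ImJE.
Qed.

Lemma cacM (p q : R) f h : p < q -> cac `]p, q[ f -> cac `]p, q[ h ->
  cac `]p, q[ (fun x => f x * h x).
Proof.
move=> pq [f1 f2] [h1 h2].
have M (u v : R -> R) : abs_continuous `]p, q[ u -> abs_continuous `]p, q[ v ->
    abs_continuous `]p, q[ (fun x => u x * v x).
  move=> uac vac; have [U hU] := abs_continuous_bounded pq uac.
  have [V hV] := abs_continuous_bounded pq vac.
  by apply: (@abs_continuousM _ _ _ _ U V).
split.
  by apply: eq_abs_continuous (abs_continuousB (M _ _ f1 h1) (M _ _ f2 h2)) => x _ /=; rewrite ReME.
by apply: eq_abs_continuous (abs_continuousD (M _ _ f1 h2) (M _ _ f2 h1)) => x _ /=; rewrite ImME.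
Qed.

Lemma cder_cst (x : R) (c : R[i]) : cder (fun=> c) x 0.
Proof. by split; exact: is_derive_cst. Qed.

Lemma cderD f h x l m : cder f x l -> cder h x m -> cder (fun x => f x + h x) x (l + m).
Proof.
move=> [f1 f2] [h1 h2]; split.
  rewrite ReDE (_ : _ \o _ = (Re \o f) + (Re \o h)); first exact: is_deriveD.
  by apply/funext => y /=; rewrite ReDE.
rewrite ImDE (_ : _ \o _ = (Im \o f) + (Im \o h)); first exact: is_deriveD.
by apply/funext => y /=; rewrite ImDE.
Qed.

Lemma cderN f x l : cder f x l -> cder (fun x => - f x) x (- l).
Proof.
move=> [f1 f2]; split.
  rewrite ReNE (_ : _ \o _ = - (Re \o f)); first exact: is_deriveN.
  by apply/funext => y /=; rewrite ReNE.
rewrite ImNE (_ : _ \o _ = - (Im \o f)); first exact: is_deriveN.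
by apply/funext => y /=; rewrite ImNE.
Qed.

Lemma cderJ f x l : cder f x l -> cder (fun x => conjc (f x)) x (conjc l).
Proof.
move=> [f1 f2]; split.
  rewrite ReJE (_ : _ \o _ = (Re \o f))//.
  by apply/funext => y /=; rewrite ReJE.
rewrite ImJE (_ : _ \o _ = - (Im \o f)); first exact: is_deriveN.
by apply/funext => y /=; rewrite ImJE.
Qed.

Lemma cderM f h x l m : cder f x l -> cder h x m ->
  cder (fun x => f x * h x) x (l * h x + f x * m).
Proof.
move=> [f1 f2] [h1 h2]; split.
  rewrite (_ : _ \o _ = (Re \o f) * (Re \o h) - (Im \o f) * (Im \o h)); last first.
    by apply/funext => y /=; rewrite ReME.
  rewrite (_ : Re _ = ((Re \o f) x *: Re m + (Re \o h) x *: Re l) -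
     ((Im \o f) x *: Im m + (Im \o h) x *: Im l)).
    by apply: is_deriveB; exact: is_deriveM.
  by rewrite !(ReDE, ReME)/= /GRing.scale/=; ring.
rewrite (_ : _ \o _ = (Re \o f) * (Im \o h) + (Im \o f) * (Re \o h)); last first.
  by apply/funext => y /=; rewrite ImME.
rewrite (_ : Im _ = ((Re \o f) x *: Im m + (Im \o h) x *: Re l) +
   ((Im \o f) x *: Re m + (Re \o h) x *: Im l)).
  by apply: is_deriveD; exact: is_deriveM.
by rewrite !(ImDE, ImME)/= /GRing.scale/=; ring.
Qed.

Lemma cder_near f h x l : (\forall y \near x, f y = h y) -> cder f x l -> cder h x l.
Proof.
move=> fh [f1 f2]; split.
  by apply: near_eq_is_derive f1; apply: filterS fh => y /= ->.
by apply: near_eq_is_derive f2; apply: filterS fh => y /= ->.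
Qed.

Lemma ccvg_cst (T : Type) (F : set_system T) {FF : Filter F} c : ccvg F (fun=> c) c.
Proof. by split; exact: cvg_cst. Qed.

Lemma ccvgD (T : Type) (F : set_system T) {FF : Filter F} (f h : T -> R[i]) l m :
  ccvg F f l -> ccvg F h m -> ccvg F (fun x => f x + h x) (l + m).
Proof.
move=> [f1 f2] [h1 h2]; split.
  by rewrite ReDE; under eq_fun do rewrite ReDE; exact: cvgD.
by rewrite ImDE; under eq_fun do rewrite ImDE; exact: cvgD.
Qed.

Lemma ccvgN (T : Type) (F : set_system T) {FF : Filter F} (f : T -> R[i]) l :
  ccvg F f l -> ccvg F (fun x => - f x) (- l).
Proof.
move=> [f1 f2]; split.
  by rewrite ReNE; under eq_fun do rewrite ReNE; exact: cvgN.
by rewrite ImNE; under eq_fun do rewrite ImNE; exact: cvgN.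
Qed.

Lemma ccvgJ (T : Type) (F : set_system T) {FF : Filter F} (f : T -> R[i]) l :
  ccvg F f l -> ccvg F (fun x => conjc (f x)) (conjc l).
Proof.
move=> [f1 f2]; split.
  by rewrite ReJE; under eq_fun do rewrite ReJE.
by rewrite ImJE; under eq_fun do rewrite ImJE; exact: cvgN.
Qed.

Lemma ccvgM (T : Type) (F : set_system T) {FF : Filter F} (f h : T -> R[i]) l m :
  ccvg F f l -> ccvg F h m -> ccvg F (fun x => f x * h x) (l * m).
Proof.
move=> [f1 f2] [h1 h2]; split.
  by rewrite ReME; under eq_fun do rewrite ReME; apply: cvgB; exact: cvgM.
by rewrite ImME; under eq_fun do rewrite ImME; apply: cvgD; exact: cvgM.
Qed.

Lemma ccvg_near (T : Type) (F : set_system T) {FF : Filter F} (f h : T -> R[i]) l :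
  (\forall x \near F, f x = h x) -> ccvg F f l -> ccvg F h l.
Proof.
move=> fh [f1 f2]; split.
  by apply: cvg_trans f1; apply: near_eq_cvg; apply: filterS fh => x ->.
by apply: cvg_trans f2; apply: near_eq_cvg; apply: filterS fh => x ->.
Qed.

(** Serves twice: for the conserved quantity [z conj(z) - w conj(w)] and for uniqueness. *)
Lemma cac_constant (p q : R) f l : p < q -> cac `]p, q[ f ->
  {ae mu, forall x, p < x < q -> cder f x 0} -> ccvg p^'+ f l ->
  forall x, p < x < q -> f x = l.
Proof.
move=> pq [f1 f2] fd [l1 l2].
have H (u : R -> R) (a : R) : abs_continuous `]p, q[ u ->
    {ae mu, forall x, p < x < q -> is_derive x 1 u 0} -> u x @[x --> p^'+] --> a ->
    forall x, p < x < q -> u x = a.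
  move=> uac ud ua x xx; rewrite (ac_FTC pq uac ud ua xx).
  by rewrite /Rintegral integral0 addr0.
move=> x xx; apply: complex_eq.
  apply: (H (Re \o f)) => //.
  by apply: (@filterS _ _ (ae_filter_ringOfSetsType mu) _ _ _ fd) => y h /h[].
apply: (H (Im \o f)) => //.
by apply: (@filterS _ _ (ae_filter_ringOfSetsType mu) _ _ _ fd) => y h /h[].
Qed.

Lemma cac_cintegral (p q : R) f : cintegrable f ->
  cac `]p, q[ (fun r => cintegral `]p, r[ f).
Proof. by move=> [f1 f2]; split; exact: integral_oo_ac. Qed.

Lemma cder_cintegral (p : R) f : cintegrable f ->
  {ae mu, forall x, p < x -> cder (fun r => cintegral `]p, r[ f) x (f x)}.
Proof.
move=> [f1 f2]; have := integral_oo_derive p f2.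
apply: (@filterS2 _ _ (ae_filter_ringOfSetsType mu) _ _ _ _ (integral_oo_derive p f1)).
by move=> x h1 h2 px; split; [exact: h1|exact: h2].
Qed.

Lemma ccvg_cintegral (p : R) f : cintegrable f ->
  ccvg p^'+ (fun r => cintegral `]p, r[ f) 0.
Proof. by move=> [f1 f2]; split; exact: integral_oo_cvg0. Qed.

Lemma cder_phase (a p x : R) :
  cder (fun y => phase (a * (y - p))) x (Complex 0 a * phase (a * (x - p))).
Proof.
have H : is_derive x 1 (fun y : R => a * (y - p)) a.
  rewrite (_ : (fun y => _) = a *: ((@id R) - cst p)); last by apply/funext => y.
  rewrite -[X in is_derive _ _ _ X](_ : a *: (1 - 0) = a); last by rewrite subr0 /GRing.scale/= mulr1.
  by apply: is_deriveZ; apply: is_deriveB.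
split; rewrite ?ReME ?ImME/=.
  rewrite (_ : _ - _ = - sin (a * (x - p)) * a); last by ring.
  by apply: (@is_derive1_comp _ cos (fun y => a * (y - p))).
rewrite (_ : _ + _ = cos (a * (x - p)) * a); last by ring.
by apply: (@is_derive1_comp _ sin (fun y => a * (y - p))).
Qed.

(** By the mean value theorem both components are Lipschitz with constant [|a|]. *)
Lemma cac_phase (a p : R) D : cac D (fun y => phase (a * (y - p))).
Proof.
have lip (u v : R -> R) : (forall x : R, is_derive x 1 u (v x)) -> (forall x, `|v x| <= `|a|) ->
    abs_continuous D u.
  move=> uv va; apply: (@abs_continuous_lipschitz _ _ _ `|a|) => // x y _ _.
  have uc : continuous u.
    by move=> z; apply/differentiable_continuous/derivable1_diffP; have [] := uv z.
  have H s t : s <= t -> `|u t - u s| <= `|a| * `|t - s|.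
    move=> st; have [|c _ ->] := MVT_segment st (fun z _ => uv z).
      exact: continuous_subspaceT.
    by rewrite normrM ler_wpM2r.
  have [xy|/ltW yx] := leP x y; last exact: H.
  by rewrite distrC (distrC x); exact: H.
have dP (x : R) := cder_phase a p x.
split.
  apply: (lip _ (fun x => - a * sin (a * (x - p)))) => x.
    by have [+ _] := dP x; rewrite ReME/= mul0r sub0r -mulNr.
  by rewrite normrM normrN ler_piMr// ler_norml sin_geN1 sin_le1.
apply: (lip _ (fun x => a * cos (a * (x - p)))) => x.
  by have [_] := dP x; rewrite ImME/= mul0r add0r.
by rewrite normrM ler_piMr// ler_norml cos_geN1 cos_le1.
Qed.

End complex_ac.

(** * The transfer matrix *)

Lemma conjCE (R : realType) (x : R[i]) : Num.conj x = conjc x.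
Proof. by []. Qed.

Section transfer_coefficients.
Context {R : realType}.
Local Open Scope complex_scope.
Local Notation mu := (@lebesgue_measure R).

Section harmonic_ode.
Variables (g : R -> R) (p sigma : R).
Hypothesis gi : mu.-integrable setT (EFin \o g).

Let hsumE : hsum g p sigma =
  fun r => 1 + cintegral `]p, r[ (fun s => kern g p sigma s * hsum g p (- sigma) s).
Proof. by apply/funext => r; exact: hsum_integral. Qed.

Lemma hsum_cac q : cac `]p, q[ (hsum g p sigma).
Proof.
rewrite hsumE; apply: cacD; first exact: cac_cst.
exact/cac_cintegral/cintegrable_kern_hsum.
Qed.

Lemma hsum_cder : {ae mu, forall x, p < x ->
  cder (hsum g p sigma) x (kern g p sigma x * conjc (hsum g p sigma x))}.
Proof.
have := cder_cintegral p (cintegrable_kern_hsum p gi sigma (- sigma)).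
apply: (@filterS _ _ (ae_filter_ringOfSetsType mu)) => x H px.
rewrite -hsumJ// -[X in cder _ _ X]add0r {1}hsumE.
by apply: cderD; [exact: cder_cst|exact: H].
Qed.

Lemma hsum_ccvg : ccvg p^'+ (hsum g p sigma) 1.
Proof.
rewrite hsumE -[X in ccvg _ _ X]addr0; apply: ccvgD; first exact: ccvg_cst.
exact/ccvg_cintegral/cintegrable_kern_hsum.
Qed.

End harmonic_ode.

Variables (g : R -> R) (p sigma : R).
Hypothesis gi : mu.-integrable setT (EFin \o g).

Let gNi : mu.-integrable setT (EFin \o (fun t => - g t)).
Proof. by apply: eq_integrable (integrableN gi) => // x _. Qed.

Let z x := z_coef g p x sigma.
Let w x := w_coef g p x sigma.
Let H1 := hsum g p sigma.
Let H2 := hsum (fun t => - g t) p sigma.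
Let ph x := phase (- sigma * (x - p)).

Let zE : z = fun x => ph x * (2^-1 * (H1 x + H2 x)).
Proof.
apply/funext => x; rewrite /z /z_coef /harm_cosh !harm_exp_hsum//; congr (_ * _).
by apply: cexp_imaginary; rewrite !(ReME, ImME, ReNE, ImNE)/=; ring.
Qed.

Let wE : w = fun x => ph x * (2^-1 * (H1 x + - H2 x)).
Proof.
apply/funext => x; rewrite /w /w_coef /harm_sinh !harm_exp_hsum//; congr (_ * _).
by apply: cexp_imaginary; rewrite !(ReME, ImME, ReNE, ImNE)/=; ring.
Qed.

Lemma coef_cac q : p < q -> cac `]p, q[ z /\ cac `]p, q[ w.
Proof.
move=> pq; rewrite zE wE; split; apply: cacM => //; try exact: cac_phase;
  apply: cacM => //; try exact: cac_cst; apply: cacD; try exact: hsum_cac.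
by apply: cacN; exact: hsum_cac.
Qed.

Lemma coef_ccvg : ccvg p^'+ z 1 /\ ccvg p^'+ w 0.
Proof.
have phc : ccvg p^'+ ph 1.
  have H : - sigma * (x - p) @[x --> p^'+] --> (0 : R).
    rewrite (_ : 0 = - sigma * (p - p)); last by rewrite subrr mulr0.
    apply: cvgM; first exact: cvg_cst.
    by apply: cvgB; [exact: cvg_at_right_filter|exact: cvg_cst].
  split => /=.
    rewrite -[X in _ --> X]cos0.
    by apply: continuous_cvg; [exact: continuous_cos|exact: H].
  rewrite -[X in _ --> X]sin0.
  by apply: continuous_cvg; [exact: continuous_sin|exact: H].
have h1 := hsum_ccvg p sigma gi; have h2 := hsum_ccvg p sigma gNi.
rewrite zE wE; split.
  rewrite [X in ccvg _ _ X](_ : 1 = 1 * (2^-1 * (1 + 1))); last by field.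
  exact: (ccvgM phc (ccvgM (ccvg_cst _) (ccvgD h1 h2))).
rewrite [X in ccvg _ _ X](_ : 0 = 1 * (2^-1 * (1 + - 1))); last by rewrite subrr !mulr0.
exact: (ccvgM phc (ccvgM (ccvg_cst _) (ccvgD h1 (ccvgN h2)))).
Qed.

Let conjM (a b : R[i]) : conjc (a * b) = conjc a * conjc b.
Proof. exact: (rmorphM (@conjc R)). Qed.

Let conjD (a b : R[i]) : conjc (a + b) = conjc a + conjc b.
Proof. exact: (rmorphD (@conjc R)). Qed.

Let conjN (h : R[i]) : conjc (- h) = - conjc h.
Proof. exact: (rmorphN (@conjc R)). Qed.

Let conj_half (P Q h1 h2 : R[i]) : conjc P = P * Q ->
  conjc (P * (2^-1 * (h1 + h2))) = P * Q * (2^-1 * (conjc h1 + conjc h2)).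
Proof.
by move=> PQ; rewrite !conjM conjD PQ conjc_inv conjc_nat.
Qed.

Lemma coef_ode : {ae mu, forall x, p < x ->
  cder z x (- ('i * sigma%:C) * z x + (g x)%:C * conjc (w x)) /\
  cder w x (- ('i * sigma%:C) * w x + (g x)%:C * conjc (z x))}.
Proof.
have := hsum_cder p sigma gNi.
apply: (@filterS2 _ _ (ae_filter_ringOfSetsType mu) _ _ _ _ (hsum_cder p sigma gi)).
move=> x d1 d2 px; have {}d1 := d1 px; have {}d2 := d2 px.
(* The phase in [kern] turns the prefactor $e^{-i\sigma(x-p)}$ into its conjugate; this is how the
   conjugates of [w] and [z] appear in the equations. *)
have phJ : conjc (ph x) = ph x * phase (2 * sigma * (x - p)).
  by rewrite /ph -phaseN -phaseD; congr phase; ring.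
have iE : Complex 0 (- sigma) = - ('i * sigma%:C).
  by apply: complex_eq; rewrite ?ReNE ?ImNE ?ReME ?ImME/=; ring.
(* The opposite sign for [- g] exchanges the sum and the difference of the two series, so that each
   equation involves the other coefficient. *)
have kN : kern (fun t => - g t) p sigma x = - kern g p sigma x.
  by rewrite /kern rmorphN mulNr.
have dph := cder_phase (- sigma) p x.
have dc := cder_cst x (2^-1 : R[i]).
rewrite -/H1 -/H2 in d1 d2.
have zx : z x = ph x * (2^-1 * (H1 x + H2 x)) by rewrite zE.
have wx : w x = ph x * (2^-1 * (H1 x + - H2 x)) by rewrite wE.
split.
  rewrite wx (conj_half _ _ phJ) conjN zx {1}zE.
  have := cderM dph (cderM dc (cderD d1 d2)).
  by congr (cder _ x _); rewrite iE kN /kern -/(ph x); ring.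
rewrite zx (conj_half _ _ phJ) wx {1}wE.
have := cderM dph (cderM dc (cderD d1 (cderN d2))).
by congr (cder _ x _); rewrite iE kN /kern -/(ph x); ring.
Qed.

Lemma coef_det x : p < x -> z x * conjc (z x) - w x * conjc (w x) = 1.
Proof.
(* Since [g] lives on the whole line, the interval may run past [x]; this also covers [x = x1] in
   the theorem. *)
move=> px; have pq : p < x + 1 by rewrite (lt_trans px)// ltrDl.
have [zac wac] := coef_cac pq; have [zc wc] := coef_ccvg.
apply: (@cac_constant _ p (x + 1) (fun x => z x * conjc (z x) - w x * conjc (w x))) => //.
- apply: cacD; first by apply: cacM => //; exact: cacJ.
  by apply: cacN; apply: cacM => //; exact: cacJ.
- apply: (@filterS _ _ (ae_filter_ringOfSetsType mu) _ _ _ coef_ode) => y H /andP[/H[dz dw] _].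
  have := cderD (cderM dz (cderJ dz)) (cderN (cderM dw (cderJ dw))).
  congr (cder _ y _).
  have iJ : conjc ('i * sigma%:C) = - ('i * sigma%:C).
    by apply: complex_eq; rewrite ?ReJE ?ImJE ?ReNE ?ImNE ?ReME ?ImME/=; ring.
  have conjE (s a b c : R[i]) : conjc s = - s -> conjc c = c ->
      conjc (- s * a + c * conjc b) = s * conjc a + c * b.
    move=> sJ cJ; rewrite conjD !conjM conjN.
    by rewrite sJ cJ opprK conjcK.
  by rewrite !conjE ?conjc_real//; ring.
- rewrite [X in ccvg _ _ X](_ : 1 = 1 * conjc 1 - 0 * conjc 0); last first.
    by rewrite mul0r subr0 mul1r; apply: complex_eq; rewrite ?ReJE ?ImJE/= ?oppr0.
  apply: ccvgD; first by apply: ccvgM => //; exact: ccvgJ.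
  by apply: ccvgN; apply: ccvgM => //; exact: ccvgJ.
- by rewrite px/= ltrDl ltr01.
Qed.

End transfer_coefficients.

(** * Vector-valued notions in terms of real and imaginary parts *)

Section vectors.
Context {R : realType}.
Local Open Scope complex_scope.
Local Notation Re := (@complex.Re R).
Local Notation Im := (@complex.Im R).
Implicit Types (A B : R -> 'cV[R[i]]_2) (L : 'cV[R[i]]_2).

Lemma norm1_le_normc (z : R[i]) : (norm1 z)%:C <= 2 * `|z|.
Proof.
rewrite normc_def [X in X * _](_ : 2 = 2%:C); last by apply: complex_eq; rewrite /= ?addr0.
rewrite -rmorphM lecR /norm1 (_ : 2 = 1 + 1)// mulrDl mul1r -!sqrtr_sqr.
by apply: lerD; rewrite ler_wsqrtr// ?lerDl ?lerDr ?sqr_ge0.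
Qed.

Lemma half_real_complex (e : R) : 2 * (e / 2)%:C = e%:C.
Proof. by rewrite -(rmorph_nat (real_complex R) 2) -rmorphM/= mulrC divfK// pnatr_eq0. Qed.

Lemma mx_entry_norm m n (M : 'M[R[i]]_(m, n)) i j : `|M i j| <= `|M|.
Proof.
have -> : `|M| = mx_norm M by [].
rewrite mx_normE -[leLHS]nngE num_le.
exact: (le_bigmax _ (fun k : 'I_m * 'I_n => `|M k.1 k.2|%:nng) (i, j)).
Qed.

Definition vnorm1 L : R := \sum_(i < 2) norm1 (L i ord0).

Lemma normv_le L : `|L| <= (vnorm1 L)%:C.
Proof.
have s0 : 0 <= vnorm1 L by apply: sumr_ge0 => i _; exact: norm1_ge0.
have -> : `|L| = mx_norm L by [].
have [->|/mx_norm_neq0[[i j] /= Lij]] := eqVneq (mx_norm L) 0; first by rewrite ler0c.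
rewrite Lij (ord1 j) (le_trans (normc_le_norm1 _))// lecR.
by rewrite /vnorm1 (bigD1 i)//= lerDl sumr_ge0// => k _; exact: norm1_ge0.
Qed.

Lemma vnorm1_le L i : (norm1 (L i ord0))%:C <= 2 * `|L|.
Proof. by rewrite (le_trans (norm1_le_normc _))// ler_wpM2l// mx_entry_norm. Qed.

Lemma cvg_vec (T : Type) (F : set_system T) {FF : Filter F} (A : T -> 'cV[R[i]]_2) L :
  (A x @[x --> F] --> L) <-> (forall i, ccvg F (fun x => A x i ord0) (L i ord0)).
Proof.
split=> [AL i|AL].
  have H e : 0 < e -> \forall x \near F, norm1 (L i ord0 - A x i ord0) < e.
    move=> e0; have e1 : 0 < (e / 2)%:C by rewrite ltcR divr_gt0.
    move/cvgrPdist_lt : AL => /(_ _ e1); apply: filterS => x Lx.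
    rewrite -ltcR; have := vnorm1_le (L - A x) i; rewrite !mxE => /le_lt_trans; apply.
    by rewrite -half_real_complex ltr_pM2l.
  split; apply/cvgrPdist_lt => e /H; apply: filterS => x; apply: le_lt_trans.
    by rewrite -ReNE -ReDE Re_norm1.
  by rewrite -ImNE -ImDE Im_norm1.
apply/cvgrPdist_lt => e /gtc0_real[e' e'0 ->].
have e20 : 0 < e' / 2 / 2 by rewrite !divr_gt0.
have H i : \forall x \near F, norm1 (L i ord0 - A x i ord0) < e' / 2.
  have [/cvgrPdist_lt /(_ _ e20) h1 /cvgrPdist_lt /(_ _ e20) h2] := AL i.
  apply: filterS2 h1 h2 => x h1 h2.
  by rewrite (splitr (e' / 2)) ltrD// ?ReDE ?ImDE ?ReNE ?ImNE.
apply: filterS2 (H ord0) (H (lift ord0 ord0)) => x h1 h2.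
rewrite (le_lt_trans (normv_le _))// ltcR /vnorm1 !big_ord_recl big_ord0 addr0 !mxE (splitr e').
exact: ltrD.
Qed.

Lemma is_derive_cvg (f : R -> R) (x l : R) :
  is_derive x 1 f l <-> h^-1 * (f (x + h) - f x) @[h --> 0^'] --> l.
Proof.
have E : (fun h : R => h^-1 * (f (x + h) - f x)) =
    (fun h => h^-1 *: ((f \o shift x) (h *: (1 : R)) - f x)).
  by apply/funext => h; rewrite /= /GRing.scale/= mulr1 (addrC h).
rewrite E; split=> [[fd <-]|fl]; first exact: fd.
have fd : derivable f x 1 by apply/cvg_ex; exists l.
apply: DeriveDef => //; apply: (cvg_unique (@Rhausdorff R) _ fl); exact: fd.
Qed.

(** The scalar [h^-1] is real, so it acts on real and imaginary parts separately. *)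
Lemma has_derivative_vec A x L :
  has_derivative A x L <-> (forall i, cder (fun y => A y i ord0) x (L i ord0)).
Proof.
have E (i : 'I_2) (h : R) : ((h^-1)%:C *: (A (x + h) - A x)) i ord0 =
    (h^-1)%:C * (A (x + h) i ord0 - A x i ord0) by rewrite !mxE.
rewrite /has_derivative cvg_vec; split=> H i; have [h1 h2] := H i; split.
- apply/is_derive_cvg; apply: cvg_trans h1; apply: near_eq_cvg; apply: nearW => h.
  by rewrite E ReME ReDE ReNE/= mul0r subr0.
- apply/is_derive_cvg; apply: cvg_trans h2; apply: near_eq_cvg; apply: nearW => h.
  by rewrite E ImME ImDE ImNE/= mul0r addr0.
- move/is_derive_cvg : h1 => h1; under eq_fun do rewrite E ReME ReDE ReNE/= mul0r subr0.
  exact: h1.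
- move/is_derive_cvg : h2 => h2; under eq_fun do rewrite E ImME ImDE ImNE/= mul0r addr0.
  exact: h2.
Qed.

Lemma abs_continuous_vec D A :
  abs_continuous D A <-> (forall i, cac D (fun x => A x i ord0)).
Proof.
split=> [Aac i|Aac].
  have H e : 0 < e -> exists2 d : R, 0 < d & forall (n : nat) (a b : 'I_n -> R),
      (forall k, a k < b k /\ `[a k, b k] `<=` D) ->
      trivIset setT (fun k => `]a k, b k[%classic) ->
      \sum_(k < n) (b k - a k) < d ->
      \sum_(k < n) norm1 (A (b k) i ord0 - A (a k) i ord0) < e.
    move=> e0; have e1 : 0 < (e / 2)%:C by rewrite ltcR divr_gt0.
    have [d d0 dA] := Aac _ e1; exists d => // n a b ab tab abd.
    have {}dA := dA n a b ab tab abd.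
    rewrite -ltcR rmorph_sum/= -half_real_complex.
    rewrite (@le_lt_trans _ _ (2 * \sum_(k < n) `|A (b k) - A (a k)|)) ?ltr_pM2l//.
    rewrite mulr_sumr; apply: ler_sum => k _.
    by have := vnorm1_le (A (b k) - A (a k)) i; rewrite !mxE.
  split=> e /H[d d0 dA]; exists d => // n a b ab tab abd;
    apply: le_lt_trans (dA n a b ab tab abd); apply: ler_sum => k _.
    by rewrite /= -ReNE -ReDE Re_norm1.
  by rewrite /= -ImNE -ImDE Im_norm1.
move=> e /gtc0_real[e' e'0 ->].
have e20 : 0 < e' / 2 / 2 by rewrite !divr_gt0.
have H i : exists2 d : R, 0 < d & forall (n : nat) (a b : 'I_n -> R),
    (forall k, a k < b k /\ `[a k, b k] `<=` D) ->
    trivIset setT (fun k => `]a k, b k[%classic) ->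
    \sum_(k < n) (b k - a k) < d ->
    \sum_(k < n) norm1 (A (b k) i ord0 - A (a k) i ord0) < e' / 2.
  have [h1 h2] := Aac i; have [d d0 dA] := h1 _ e20; have [d' d'0 dA'] := h2 _ e20.
  exists (Num.min d d'); first by rewrite lt_min d0.
  move=> n a b ab tab; rewrite lt_min => /andP[abd abd'].
  rewrite (splitr (e' / 2)) big_split/= ltrD//.
    apply: le_lt_trans (dA n a b ab tab abd); apply: ler_sum => k _.
    by rewrite /= ReDE ReNE.
  apply: le_lt_trans (dA' n a b ab tab abd'); apply: ler_sum => k _.
  by rewrite /= ImDE ImNE.
have [d d0 dA] := H ord0; have [d' d'0 dA'] := H (lift ord0 ord0).
exists (Num.min d d'); first by rewrite lt_min d0.
move=> n a b ab tab; rewrite lt_min => /andP[abd abd'].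
rewrite (@le_lt_trans _ _ (\sum_(k < n) vnorm1 (A (b k) - A (a k)))%:C)//.
  by rewrite rmorph_sum/=; apply: ler_sum => k _; exact: normv_le.
rewrite ltcR (splitr e') (le_lt_trans _ (ltrD (dA n a b ab tab abd) (dA' n a b ab tab abd')))//.
rewrite -big_split/=; apply: ler_sum => k _.
by rewrite /vnorm1 !big_ord_recl big_ord0 addr0 !mxE.
Qed.

End vectors.

(** * An integrable representative of the reflectivity *)

Section reflectivity_density.
Context {R : realType}.
Local Open Scope complex_scope.
Local Notation mu := (@lebesgue_measure R).

(** For [y <= x], $\ln x-\ln y=\ln(1+(x-y)/y)\le(x-y)/y$. *)
Lemma ln_lipschitz (C x y : R) : 0 < x -> 0 < y -> x^-1 <= C -> y^-1 <= C ->
  `|ln x - ln y| <= C * `|x - y|.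
Proof.
wlog xy : x y / y <= x => [hw x0 y0 xC yC|x0 y0 _ yC].
  have [yx|/ltW xy] := leP y x; first exact: hw.
  by rewrite distrC (distrC x) hw.
rewrite !ger0_norm ?subr_ge0 ?ler_ln ?posrE// -ln_div ?posrE//.
have -> : x / y = 1 + (x - y) / y by field; rewrite gt_eqF.
rewrite (le_trans (le_ln1Dx _))//.
  by rewrite (lt_le_trans (_ : -1 < 0))// ?ltrN10// divr_ge0 ?subr_ge0// ltW.
by rewrite mulrC ler_wpM2r ?subr_ge0.
Qed.

(** The bound on [1/zeta] makes [ln] Lipschitz on the range of [zeta], so [ln zeta] inherits
    absolute continuity. *)
Lemma reflectivity_density (x0 x1 : R) (zeta : R -> R) : x0 < x1 ->
  (forall x, x0 < x < x1 -> 0 < zeta x) ->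
  [bounded (zeta x)^-1 | x in `]x0, x1[%classic] ->
  abs_continuous `]x0, x1[ zeta ->
  exists2 g : R -> R, mu.-integrable setT (EFin \o g) &
    {ae mu, forall x, x0 < x < x1 -> reflectivity zeta x = g x}.
Proof.
move=> x01 z0 [M [_ zM]] zac.
(* Boundedness gives every threshold strictly above [M]; [|M| + 1] is one, and it is nonnegative. *)
have zC x : x0 < x < x1 -> (zeta x)^-1 <= `|M| + 1.
  move=> xx; have := zM (`|M| + 1); rewrite (le_lt_trans (ler_norm M)) ?ltrDl//.
  by move=> /(_ isT x) /=; rewrite in_itv/= => /(_ xx) /(le_trans (ler_norm _)).
have lac : abs_continuous `]x0, x1[ (fun y => ln (zeta y)).
  apply: (@abs_continuous_le _ _ zeta zeta _ (`|M| + 1) 0) => // x y.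
  rewrite /= !in_itv/= => xx yy; rewrite mul0r addr0.
  by apply: ln_lipschitz; rewrite ?z0 ?zC.
have [g [c [gi gE]]] := ac_primitive x01 lac.
exists (fun x => - 2^-1 * g x).
  by apply: eq_integrable (integrableZl measurableT (- 2^-1) gi) => // x _.
have := ac_derive gi gE.
apply: (@filterS _ _ (ae_filter_ringOfSetsType mu)) => x H /H dx.
by rewrite /reflectivity derive1E; have /@derive_val -> := dx.
Qed.

Lemma harm_exp_ae (p q r : R) (a b : R -> R) (sigma : R[i]) :
  {ae mu, forall t, p < t < q -> a t = b t} -> r <= q ->
  harm_exp p r a sigma = harm_exp p r b sigma.
Proof.
move=> ab rq; rewrite /harm_exp.
by under [X in limn X]eq_fun do under eq_bigr do rewrite (simplex_integral_ae ab
  _ (fun s => cexp (2 * 'i%C * sigma * (kappa p s)%:C)) rq).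
Qed.

Lemma coef_ae (p q r sigma : R) (a b : R -> R) :
  {ae mu, forall t, p < t < q -> a t = b t} -> r <= q ->
  z_coef a p r sigma = z_coef b p r sigma /\ w_coef a p r sigma = w_coef b p r sigma.
Proof.
move=> ab rq; have abN : {ae mu, forall t, p < t < q -> - a t = - b t}.
  by apply: (@filterS _ _ (ae_filter_ringOfSetsType mu) _ _ _ ab) => t h /h ->.
rewrite /z_coef /w_coef /harm_cosh /harm_sinh.
by rewrite (harm_exp_ae _ ab rq) (harm_exp_ae _ abN rq).
Qed.

End reflectivity_density.

(** * Two by two matrices and the group SU(1,1) *)

Section mx22.
Context {C : comNzRingType}.

Lemma mx22_mulv (a b c d : C) (v : 'cV[C]_2) :
  (mx22 a b c d *m v) ord0 ord0 = a * v ord0 ord0 + b * v (lift ord0 ord0) ord0 /\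
  (mx22 a b c d *m v) (lift ord0 ord0) ord0 =
    c * v ord0 ord0 + d * v (lift ord0 ord0) ord0.
Proof. by split; rewrite mxE !big_ord_recl big_ord0 addr0 !mxE. Qed.

Lemma mulmx22 (a b c d a' b' c' d' : C) :
  mx22 a b c d *m mx22 a' b' c' d' =
  mx22 (a * a' + b * c') (a * b' + b * d') (c * a' + d * c') (c * b' + d * d').
Proof.
apply/matrixP => i j; rewrite !mxE !big_ord_recl big_ord0 addr0 !mxE/=.
by case: ifP => _; case: ifP.
Qed.

Lemma ord2P (P : 'I_2 -> Prop) : P ord0 -> P (lift ord0 ord0) -> forall i, P i.
Proof.
move=> P0 P1 i; have [->//|] := eqVneq i ord0.
by case: (unliftP ord0 i) => [j ->|->]; rewrite ?eqxx// (ord1 j).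
Qed.

Lemma det_mx22 (a b c d : C) : \det (mx22 a b c d) = a * d - b * c.
Proof.
rewrite (expand_det_row _ ord0) !big_ord_recl big_ord0 addr0 /cofactor !det_mx11 !mxE/=.
by ring.
Qed.

End mx22.

Section SU11.
Local Open Scope sesquilinear_scope.

Lemma mx22_adjoint (R : realType) (a b c d : R[i]) :
  (mx22 a b c d) ^t* = mx22 (conjc a) (conjc c) (conjc b) (conjc d).
Proof.
by apply/matrixP => i j; rewrite !mxE; case: ifP => _; case: ifP => _; rewrite conjCE.
Qed.

Lemma Gmx_SU11 (R : realType) (a : R -> R) (p r sigma : R) :
  z_coef a p r sigma * conjc (z_coef a p r sigma) -
  w_coef a p r sigma * conjc (w_coef a p r sigma) = 1 -> SU11 (Gmx a p r sigma).
Proof.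
rewrite /SU11 /Gmx/= conjCE; set z := z_coef _ _ _ _; set w := w_coef _ _ _ _ => zw.
have conjN (h : R[i]) : conjc (- h) = - conjc h by exact: (rmorphN (@conjc R)).
split; first by rewrite det_mx22 -[RHS]zw; ring.
rewrite mx22_adjoint !conjN !conjcK /Lambda !mulmx22.
congr mx22; [rewrite -[RHS]zw|idtac|idtac|rewrite -[in RHS]zw]; ring.
Qed.

End SU11.

Theorem theorem1 (R : realType) (x0 x1 : R) (zeta : R -> R) :
  x0 < x1 ->
  (forall x, x0 < x < x1 -> 0 < zeta x) ->
  [bounded zeta x | x in `]x0, x1[%classic] ->
  [bounded (zeta x)^-1 | x in `]x0, x1[%classic] ->
  abs_continuous `]x0, x1[ zeta ->
  let alpha := reflectivity zeta in
  (forall x sigma : R, x0 < x <= x1 -> SU11 (Gmx alpha x0 x sigma)) /\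
  (forall (sigma : R) (A0 : 'cV[R[i]]_2),
     let A := fun x : R => Gmx alpha x0 x sigma *m A0 in
     [/\ is_solution alpha sigma x0 x1 A,
         A x @[x --> x0^'+] --> A0 &
         forall B : R -> 'cV[R[i]]_2,
           is_solution alpha sigma x0 x1 B ->
           B x @[x --> x0^'+] --> A0 ->
           forall x, x0 < x < x1 -> B x = A x]).
Proof.
move=> x01 zeta_gt0 _ zetaV_bounded zeta_ac alpha.
have [g gi ag] := reflectivity_density x01 zeta_gt0 zetaV_bounded zeta_ac.
(* [alpha] and [g] agree on the open interval only; integrals up to [x1], end point included, see
   nothing else. *)
have coefE sigma x : x <= x1 -> z_coef alpha x0 x sigma = z_coef g x0 x sigma /\
    w_coef alpha x0 x sigma = w_coef g x0 x sigma.
  by move=> xx1; exact: coef_ae ag xx1.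
have det1 sigma x : x0 < x <= x1 ->
    z_coef alpha x0 x sigma * conjc (z_coef alpha x0 x sigma) -
    w_coef alpha x0 x sigma * conjc (w_coef alpha x0 x sigma) = 1.
  by move=> /andP[x0x xx1]; have [-> ->] := coefE sigma x xx1; exact: coef_det.
split=> [x sigma xx|sigma A0 A]; first exact/Gmx_SU11/det1.
pose z x := z_coef g x0 x sigma; pose w x := w_coef g x0 x sigma.
pose i0 := ord0 : 'I_2; pose i1 := lift ord0 ord0 : 'I_2.
have A_0 x : x <= x1 -> A x i0 ord0 = z x * A0 i0 ord0 - w x * A0 i1 ord0.
  move=> xx1; rewrite /A /Gmx (mx22_mulv _ _ _ _ A0).1 mulNr.
  by have [-> ->] := coefE sigma x xx1.
have A_1 x : x <= x1 -> A x i1 ord0 = - conjc (w x) * A0 i0 ord0 + conjc (z x) * A0 i1 ord0.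
  move=> xx1; rewrite /A /Gmx (mx22_mulv _ _ _ _ A0).2 conjCE.
  by have [-> ->] := coefE sigma x xx1.
have [zac wac] : cac `]x0, x1[ z /\ cac `]x0, x1[ w by exact: coef_cac.
have [zc wc] : ccvg x0^'+ z 1 /\ ccvg x0^'+ w 0 by exact: coef_ccvg.
have ode := coef_ode x0 sigma gi; rewrite -/z -/w in ode.
pose s : R[i] := 'i%C * (real_complex R sigma).
have sJ : conjc s = - s.
  by apply: complex_eq; rewrite ?ReJE ?ImJE ?ReNE ?ImNE ?ReME ?ImME/=; ring.
have conjE (c a b : R[i]) : conjc c = c -> conjc (- s * a + c * conjc b) = s * conjc a + c * b.
  move=> cJ; rewrite (_ : conjc _ = conjc (- s * a) + conjc (c * conjc b)); last exact: (rmorphD (@conjc R)).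
  rewrite (_ : conjc (- s * a) = conjc (- s) * conjc a); last exact: (rmorphM (@conjc R)).
  rewrite (_ : conjc (- s) = - conjc s); last exact: (rmorphN (@conjc R)).
  rewrite (_ : conjc (c * conjc b) = conjc c * conjc (conjc b)); last exact: (rmorphM (@conjc R)).
  by rewrite sJ cJ opprK conjcK.
have ccvg_eq f (l m : R[i]) : ccvg x0^'+ f l -> l = m -> ccvg x0^'+ f m by move=> + <-.
split.
- split.
    apply/abs_continuous_vec; apply: ord2P.
      apply: (@eq_cac _ _ (fun x => z x * A0 i0 ord0 + - (w x * A0 i1 ord0))).
        by move=> x /=; rewrite in_itv/= => /andP[_ /ltW/A_0].
      by apply: cacD; [|apply: cacN]; apply: cacM => //; exact: cac_cst.
    apply: (@eq_cac _ _ (fun x => - conjc (w x) * A0 i0 ord0 + conjc (z x) * A0 i1 ord0)).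
      by move=> x /=; rewrite in_itv/= => /andP[_ /ltW/A_1].
    apply: cacD; apply: cacM => //; try exact: cac_cst; last exact: cacJ.
    by apply: cacN; exact: cacJ.
  apply: (@filterS2 _ _ (ae_filter_ringOfSetsType lebesgue_measure) _ _ _ _ ode ag).
  move=> x dzw agx xx; have /andP[x0x xx1] := xx.
  have [dz dw] := dzw x0x.
  exists (- (sysmx alpha sigma x *m A x)); last by rewrite addNr.
  (* The formulas in [g] hold up to [x1] only, so derivatives are transferred on a neighbourhood of
     the interior point [x]. *)
  have nearx : \forall y \near x, y <= x1 by near=> y; apply/ltW; near: y; exact: lt_nbhsl.
  apply/has_derivative_vec; apply: ord2P.
    rewrite mxE (mx22_mulv _ _ _ _ (A x)).1 (A_0 x (ltW xx1)) (A_1 x (ltW xx1)) /alpha agx//.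
    apply: (@cder_near _ (fun y => z y * A0 i0 ord0 + - (w y * A0 i1 ord0))).
      by apply: filterS nearx => y /A_0.
    have := cderD (cderM dz (cder_cst x (A0 i0 ord0))) (cderN (cderM dw (cder_cst x (A0 i1 ord0)))).
    by congr (cder _ x _); rewrite -/s /z /w; ring.
  rewrite mxE (mx22_mulv _ _ _ _ (A x)).2 (A_0 x (ltW xx1)) (A_1 x (ltW xx1)) /alpha agx//.
  apply: (@cder_near _ (fun y => - conjc (w y) * A0 i0 ord0 + conjc (z y) * A0 i1 ord0)).
    by apply: filterS nearx => y /A_1.
  have := cderD (cderM (cderN (cderJ dw)) (cder_cst x (A0 i0 ord0)))
    (cderM (cderJ dz) (cder_cst x (A0 i1 ord0))).
  by congr (cder _ x _); rewrite -/s /z /w !conjE ?conjc_real//; ring.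
- have nearx0 : \forall y \near x0^'+, y <= x1 by near=> y; apply/ltW; near: y; exact: nbhs_right_lt.
  have c0 : conjc 0 = 0 :> R[i] by apply: complex_eq; rewrite /= ?oppr0.
  have c1 : conjc 1 = 1 :> R[i] by apply: complex_eq; rewrite /= ?oppr0.
  apply/cvg_vec; apply: ord2P.
    apply: (@ccvg_near _ _ _ _ (fun y => z y * A0 i0 ord0 + - (w y * A0 i1 ord0))).
      by apply: filterS nearx0 => y /A_0.
    apply: (ccvg_eq _ _ _ (ccvgD (ccvgM zc (ccvg_cst (A0 i0 ord0))) (ccvgN (ccvgM wc (ccvg_cst (A0 i1 ord0)))))).
    by ring.
  apply: (@ccvg_near _ _ _ _ (fun y => - conjc (w y) * A0 i0 ord0 + conjc (z y) * A0 i1 ord0)).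
    by apply: filterS nearx0 => y /A_1.
  apply: (ccvg_eq _ _ _ (ccvgD (ccvgM (ccvgN (ccvgJ wc)) (ccvg_cst (A0 i0 ord0)))
    (ccvgM (ccvgJ zc) (ccvg_cst (A0 i1 ord0))))).
  by rewrite c0 c1; ring.
- move=> B [/abs_continuous_vec Bac Bode] /cvg_vec Bc x xx.
  have c0 : conjc 0 = 0 :> R[i] by apply: complex_eq; rewrite /= ?oppr0.
  have c1 : conjc 1 = 1 :> R[i] by apply: complex_eq; rewrite /= ?oppr0.
  have Bd : {ae lebesgue_measure, forall y, x0 < y < x1 ->
      cder (fun t => B t i0 ord0) y (- (s * B y i0 ord0 + (real_complex R (g y)) * B y i1 ord0)) /\
      cder (fun t => B t i1 ord0) y (- ((real_complex R (g y)) * B y i0 ord0 - s * B y i1 ord0))}.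
    apply: (@filterS2 _ _ (ae_filter_ringOfSetsType lebesgue_measure) _ _ _ _ Bode ag).
    move=> y + agy yy; move=> /(_ yy)[L /has_derivative_vec LB /eqP].
    rewrite addr_eq0 => /eqP LE; split.
      have := LB i0; rewrite LE mxE (mx22_mulv _ _ _ _ (B y)).1 /alpha agy//.
    by have := LB i1; rewrite LE mxE (mx22_mulv _ _ _ _ (B y)).2 /alpha agy// mulNr.
  (* With determinant 1 the inverse of [G] has rows [(conj z, w)] and [(conj w, z)]; [Y0] and [Y1]
     say that the components of [G^(-1) B] are constant, equal to their limits at [x0]. *)
  have Y0 : conjc (z x) * B x i0 ord0 + w x * B x i1 ord0 = A0 i0 ord0.
    apply: (@cac_constant _ x0 x1 (fun y => conjc (z y) * B y i0 ord0 + w y * B y i1 ord0)) => //.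
    + by apply: cacD; apply: cacM => //; exact: cacJ.
    + apply: (@filterS2 _ _ (ae_filter_ringOfSetsType lebesgue_measure) _ _ _ _ ode Bd).
      move=> y h1 h2 yy; have [d1 d2] := h2 yy; have [dz dw] := h1 (proj1 (andP yy)).
      have := cderD (cderM (cderJ dz) d1) (cderM dw d2).
      by congr (cder _ y _); rewrite -/s /z /w !conjE ?conjc_real//; ring.
    + apply: (ccvg_eq _ _ _ (ccvgD (ccvgM (ccvgJ zc) (Bc i0)) (ccvgM wc (Bc i1)))).
      by rewrite c1; ring.
  have Y1 : conjc (w x) * B x i0 ord0 + z x * B x i1 ord0 = A0 i1 ord0.
    apply: (@cac_constant _ x0 x1 (fun y => conjc (w y) * B y i0 ord0 + z y * B y i1 ord0)) => //.
    + by apply: cacD; apply: cacM => //; exact: cacJ.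
    + apply: (@filterS2 _ _ (ae_filter_ringOfSetsType lebesgue_measure) _ _ _ _ ode Bd).
      move=> y h1 h2 yy; have [d1 d2] := h2 yy; have [dz dw] := h1 (proj1 (andP yy)).
      have := cderD (cderM (cderJ dw) d1) (cderM dz d2).
      by congr (cder _ y _); rewrite -/s /z /w !conjE ?conjc_real//; ring.
    + apply: (ccvg_eq _ _ _ (ccvgD (ccvgM (ccvgJ wc) (Bc i0)) (ccvgM zc (Bc i1)))).
      by rewrite c0; ring.
  have /andP[x0x xx1] := xx; have zw := coef_det sigma gi x0x; rewrite -/z -/w in zw.
  (* Applying [G] to this constant vector gives back [B], the determinant being written in place of
     the factor 1. *)
  apply/matrixP => i j; rewrite (ord1 j : j = ord0); move: i; apply: ord2P.
    rewrite A_0 ?ltW// -Y0 -Y1 -[LHS]mul1r -zw /i0 /i1 /z /w; ring.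
  rewrite A_1 ?ltW// -Y0 -Y1 -[LHS]mul1r -zw /i0 /i1 /z /w; ring.
Unshelve. all: by end_near. Qed.
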